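(* Let $A$ and $B$ be finite-dimensional quantum systems of dimensions $d_A$ and $d_B$. The minimum of the base norm $\|\widetilde{\mathcal{C}}\|_{\mathrm{base}}$ over all 1-slot virtual combs $\widetilde{\mathcal{C}}$ satisfying $\widetilde{\mathcal{C}}(\mathcal{N})=\mathcal{N}^*$ for all $\mathcal{N}\in\mathrm{CPTP}(A,B)$ is $d_Ad_B-d_A+1$.
   Context: A quantum system $A$ is a $d_A$-dimensional complex Hilbert space with a fixed orthonormal basis; $\mathscr{L}_A$ is the space of linear operators on it. $\mathrm{CPTP}(A,B)$ is the set of quantum channels, i.e. completely positive trace-preserving linear maps $\mathscr{L}_A\to\mathscr{L}_B$. For a channel with Kraus representation $\mathcal{N}(\cdot)=\sum_j K_j(\cdot)K_j^\dagger$, its complex conjugate is $\mathcal{N}^*(\cdot)=\sum_j K_j^*(\cdot)K_j^{\mathsf T}$ (complex conjugate and transpose in the fixed bases). The Choi operator of a linear map $\mathcal{N}:\mathscr{L}_A\to\mathscr{L}_B$ is $\mathsf{N}_{AB}=\sum_{i,j}|i\rangle\langle j|\otimes\mathcal{N}(|i\rangle\langle j|)$; the Choi operator of $\mathcal{N}^*$ is $\mathsf{N}_{AB}^{\mathsf T}$. A 1-slot linear supermap $\mathcal{C}$ from maps $\mathscr{L}_A\to\mathscr{L}_B$ to maps $\mathscr{L}_{A'}\to\mathscr{L}_{B'}$ (here $A'\cong A$, $B'\cong B$) is specified by its Choi operator $\mathsf{C}_{A'ABB'}$: the Choi operator of $\mathcal{C}(\mathcal{N})$ on $A'B'$ is $\mathrm{Tr}_{AB}\big[\mathsf{C}_{A'ABB'}(\mathsf{N}_{AB}^{\mathsf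 T}\otimes\mathbb{1}_{A'B'})\big]$. It is a 1-slot quantum comb if $\mathsf{C}_{A'ABB'}\ge 0$, $\mathrm{Tr}_{B'}\mathsf{C}_{A'ABB'}=\mathrm{Tr}_{BB'}\mathsf{C}_{A'ABB'}\otimes\frac{\mathbb{1}_B}{d_B}$, and $\mathrm{Tr}_{AB'}\mathsf{C}_{A'ABB'}=\mathbb{1}_{A'B}$; $\mathsf{Comb}_1$ denotes the set of 1-slot quantum combs. A 1-slot virtual comb is a supermap of the form $\widetilde{\mathcal{C}}=\sum_i\alpha_i\mathcal{C}_i$ (finite sum) with $\alpha_i\in\mathbb{R}$, $\sum_i\alpha_i=1$, $\mathcal{C}_i\in\mathsf{Comb}_1$. Its base norm is $$\|\widetilde{\mathcal{C}}\|_{\mathrm{base}}=\min_{\alpha_\pm\ge 0}\{\alpha_++\alpha_-:\ \widetilde{\mathcal{C}}=\alpha_+\mathcal{C}_+-\alpha_-\mathcal{C}_-,\ \mathcal{C}_\pm\in\mathsf{Comb}_1\}.$$ *)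

(* Defs.v *)
Set Warnings "-notation-overridden,-ambiguous-paths,-notation-incompatible-prefix".
From mathcomp Require Import all_boot all_order all_algebra.
From mathcomp Require Import all_classical all_reals all_analysis.
From mathcomp Require Import complex mxtens.
From mathcomp Require Import ring lra.
Set Implicit Arguments.
Unset Strict Implicit.
Unset Printing Implicit Defensive.
Import Order.TTheory GRing.Theory Num.Theory.
Import numFieldNormedType.Exports.

Local Open Scope classical_set_scope.
Local Open Scope ring_scope.
Local Open Scope complex_scope.
Local Open Scope sesquilinear_scope.

(* An operator on a d-dimensional system is a matrix 'M[R[i]]_d in the fixed
   orthonormal basis; for a composite system the tensor factors are ordered by
   mxtens_index, as in tensmx. *)

Section Operators.
Variable R : realType.
Local Notation C := R[i].

(* In R[i], 0 <= z means that z is real and nonnegative, so positive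
   semidefinite operators are Hermitian. *)
Definition psdmx (n : nat) (X : 'M[C]_n) : Prop :=
  forall v : 'cV[C]_n, 0 <= (v^t* *m X *m v) 0 0.

Definition ptracel (m n : nat) (X : 'M[C]_(m * n)) : 'M[C]_n :=
  \matrix_(i, j) \sum_(k < m) X (mxtens_index (k, i)) (mxtens_index (k, j)).

Definition ptracer (m n : nat) (X : 'M[C]_(m * n)) : 'M[C]_m :=
  \matrix_(i, j) \sum_(k < n) X (mxtens_index (i, k)) (mxtens_index (j, k)).

Definition ptracem (m n p : nat) (X : 'M[C]_(m * n * p)) : 'M[C]_(m * p) :=
  \matrix_(i, j) \sum_(k < n)
    X (mxtens_index (mxtens_index ((mxtens_unindex i).1, k),
                     (mxtens_unindex i).2))
      (mxtens_index (mxtens_index ((mxtens_unindex j).1, k),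
                     (mxtens_unindex j).2)).

End Operators.

Section Channels.
Variable R : realType.
Local Notation C := R[i].
Variables dA dB : nat.

Definition choi (N : 'M[C]_dA -> 'M[C]_dB) : 'M[C]_(dA * dB) :=
  \sum_(i < dA) \sum_(j < dA) delta_mx i j *t N (delta_mx i j).

(* The linear map with Choi operator J, i.e. X |-> Tr_A[(X^T (x) 1_B) J];
   see of_choiK and choiK below. *)
Definition of_choi (J : 'M[C]_(dA * dB)) (X : 'M[C]_dA) : 'M[C]_dB :=
  ptracel ((X^T *t 1%:M) *m J).

(* id_k (x) N. *)
Definition tens_id (k : nat) (N : 'M[C]_dA -> 'M[C]_dB)
    (X : 'M[C]_(k * dA)) : 'M[C]_(k * dB) :=
  \sum_(i < k) \sum_(j < k) delta_mx i j *t
    N (\matrix_(a, b) X (mxtens_index (i, a)) (mxtens_index (j, b))).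

Definition completely_positive (N : 'M[C]_dA -> 'M[C]_dB) : Prop :=
  forall (k : nat) (X : 'M[C]_(k * dA)), psdmx X -> psdmx (tens_id N X).

Definition trace_preserving (N : 'M[C]_dA -> 'M[C]_dB) : Prop :=
  forall X : 'M[C]_dA, \tr (N X) = \tr X.

Definition cptp (N : {linear 'M[C]_dA -> 'M[C]_dB}) : Prop :=
  completely_positive N /\ trace_preserving N.

(* N' is the complex conjugate of N, read off from a Kraus representation of N.
   Every completely positive N has such an N' (cp_conj_map below), with Choi
   operator (choi N)^T whatever the Kraus representation (choi_conj_map). *)
Definition is_conj_map (N N' : 'M[C]_dA -> 'M[C]_dB) : Prop :=
  exists (r : nat) (K : 'I_r -> 'M[C]_(dB, dA)),
    (forall X, N X = \sum_(j < r) K j *m X *m (K j)^t*) /\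
    (forall X, N' X = \sum_(j < r) map_mx Num.conj (K j) *m X *m (K j)^T).

End Channels.

Section Combs.
Variable R : realType.
Local Notation C := R[i].
Variables dA dB : nat.

(* The Choi operator of a supermap; the factors of dA * dA * dB * dB are, in
   this order, A', A, B, B'. *)
Definition superop : Type := 'M[C]_(dA * dA * dB * dB).

Definition comb (X : superop) : Prop :=
  [/\ psdmx X,
      ptracer X = ptracer (ptracer X) *t (dB%:R^-1 *: 1%:M) &
      ptracem (ptracer X) = 1%:M].

Lemma reassoc : (dA * (dA * dB) * dB = dA * dA * dB * dB)%N.
Proof. by rewrite mulnA. Qed.

(* J_AB (x) 1_A'B', as an operator on A'ABB'; see ext_ABE below. *)
Definition ext_AB (J : 'M[C]_(dA * dB)) : superop :=
  castmx (reassoc, reassoc) (1%:M *t J *t 1%:M).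

Definition ptrace_AB (X : superop) : 'M[C]_(dA * dB) :=
  ptracem (ptracem (m := dA * dA) X).

Definition supermap_app (X : superop) (N : 'M[C]_dA -> 'M[C]_dB) :
    'M[C]_dA -> 'M[C]_dB :=
  of_choi (ptrace_AB (X *m ext_AB (choi N)^T)).

Definition conjugates_channels (X : superop) : Prop :=
  forall N : {linear 'M[C]_dA -> 'M[C]_dB}, cptp N ->
  forall N' : 'M[C]_dA -> 'M[C]_dB, is_conj_map N N' ->
  forall Y : 'M[C]_dA, supermap_app X N Y = N' Y.

Definition virtual_comb (X : superop) : Prop :=
  exists (n : nat) (a : 'I_n -> R) (Z : 'I_n -> superop),
    [/\ \sum_(i < n) a i = 1, forall i, comb (Z i) &
        X = \sum_(i < n) (a i)%:C *: Z i].

Definition comb_decomp (X : superop) (ap am : R) (Xp Xm : superop) : Prop :=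
  [/\ 0 <= ap, 0 <= am, comb Xp, comb Xm & X = ap%:C *: Xp - am%:C *: Xm].

Definition base_norm_set (X : superop) : set R :=
  [set x | exists ap am Xp Xm, comb_decomp X ap am Xp Xm /\ x = ap + am].

(* For a virtual comb the infimum is attained: see base_norm_attained below. *)
Definition base_norm (X : superop) : R := inf (base_norm_set X).

End Combs.

Section ChoiLemmas.
Variable R : realType.
Local Notation C := R[i].
Variables dA dB : nat.

Lemma choiE (N : 'M[C]_dA -> 'M[C]_dB) i j k l :
  choi N (mxtens_index (i, k)) (mxtens_index (j, l)) = N (delta_mx i j) k l.
Proof.
rewrite /choi summxE (bigD1 i)//= summxE (bigD1 j)//= tensmxE mxE !eqxx mul1r.
rewrite [X in _ + X + _]big1 => [|j' /negbTE jj']; last first.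
  by rewrite tensmxE mxE eqxx (eq_sym j) jj' mul0r.
rewrite [X in _ + _ + X]big1 ?addr0// => i' /negbTE ii'.
by rewrite summxE big1// => j' _; rewrite tensmxE mxE (eq_sym i) ii' mul0r.
Qed.

Lemma of_choiE (J : 'M[C]_(dA * dB)) X k l :
  of_choi J X k l =
  \sum_i \sum_j X i j * J (mxtens_index (i, k)) (mxtens_index (j, l)).
Proof.
rewrite /of_choi mxE exchange_big /=; apply: eq_bigr => j _.
rewrite mxE (reindex (@mxtens_index dA dB)) /=; last first.
  by exists (@mxtens_unindex dA dB) => x _;
    [exact: mxtens_indexK|exact: mxtens_unindexK].
rewrite [RHS](eq_bigr (fun i => \sum_(b < dB) X i j *
   (k == b)%:R * J (mxtens_index (i, b)) (mxtens_index (j, l)))).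
  rewrite pair_big /=; apply: eq_bigr => -[i b] _ /=.
  by rewrite tensmxE !mxE.
move=> i _; rewrite (bigD1 k)//= eqxx mulr1 big1 ?addr0// => b /negbTE kb.
by rewrite eq_sym kb mulr0 mul0r.
Qed.

Lemma of_choiK (J : 'M[C]_(dA * dB)) : choi (of_choi J) = J.
Proof.
apply/matrixP => x y.
case: (mxtens_indexP x) => i k; case: (mxtens_indexP y) => j l.
rewrite choiE of_choiE (bigD1 i)//= (bigD1 j)//= mxE !eqxx mul1r.
rewrite [X in _ + X + _]big1 => [|j' /negbTE jj']; last first.
  by rewrite mxE eqxx jj' mul0r.
rewrite [X in _ + _ + X]big1 ?addr0// => i' /negbTE ii'.
by rewrite big1// => j' _; rewrite mxE ii' mul0r.
Qed.

Lemma choiK (N : {linear 'M[C]_dA -> 'M[C]_dB}) : of_choi (choi N) =1 N.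
Proof.
move=> X; apply/matrixP => k l; rewrite of_choiE.
rewrite [X in N X]matrix_sum_delta linear_sum summxE; apply: eq_bigr => i _.
rewrite linear_sum summxE; apply: eq_bigr => j _.
by rewrite choiE linearZ mxE.
Qed.

End ChoiLemmas.

Section BaseNorm.
Variable R : realType.
Local Notation C := R[i].
Variables dA dB : nat.

Lemma mxtrace_ptracer m n (X : 'M[C]_(m * n)) : \tr (ptracer X) = \tr X.
Proof.
rewrite /mxtrace [RHS](reindex (@mxtens_index m n)) /=; last first.
  by exists (@mxtens_unindex m n) => x _;
    [exact: mxtens_indexK|exact: mxtens_unindexK].
rewrite (eq_bigr (fun i => \sum_(k < n)
  X (mxtens_index (i, k)) (mxtens_index (i, k)))) => [|i _]; last by rewrite mxE.
by rewrite pair_big /=; apply: eq_bigr => -[].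
Qed.

Lemma mxtrace_ptracem m n p (X : 'M[C]_(m * n * p)) :
  \tr (ptracem X) = \tr X.
Proof.
rewrite /mxtrace [RHS](reindex (@mxtens_index (m * n) p)) /=; last first.
  by exists (@mxtens_unindex (m * n) p) => x _;
    [exact: mxtens_indexK|exact: mxtens_unindexK].
rewrite (reindex (@mxtens_index m p)) /=; last first.
  by exists (@mxtens_unindex m p) => x _;
    [exact: mxtens_indexK|exact: mxtens_unindexK].
under eq_bigr do rewrite mxE mxtens_indexK.
rewrite -(pair_big xpredT xpredT (fun i b => \sum_(k < n)
  X (mxtens_index (mxtens_index (i, k), b))
    (mxtens_index (mxtens_index (i, k), b)))) /=.
rewrite [RHS](eq_bigr (fun u => X (mxtens_index (u.1, u.2))
   (mxtens_index (u.1, u.2)))) => [|[]//].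
rewrite -[RHS](pair_big xpredT xpredT (fun u b =>
  X (mxtens_index (u, b)) (mxtens_index (u, b)))) /=.
rewrite [RHS](reindex (@mxtens_index m n)) /=; last first.
  by exists (@mxtens_unindex m n) => x _;
    [exact: mxtens_indexK|exact: mxtens_unindexK].
rewrite [RHS](eq_bigr (fun u => \sum_(b < p)
  X (mxtens_index (mxtens_index (u.1, u.2), b))
    (mxtens_index (mxtens_index (u.1, u.2), b)))) => [|[]//].
rewrite -[RHS](pair_big xpredT xpredT (fun i k => \sum_(b < p)
  X (mxtens_index (mxtens_index (i, k), b))
    (mxtens_index (mxtens_index (i, k), b)))) /=.
by apply: eq_bigr => i _; rewrite exchange_big.
Qed.

Lemma comb_tr (X : superop R dA dB) : comb X -> \tr X = (dA * dB)%:R.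
Proof.
by case=> _ _ h; rewrite -mxtrace_ptracer -mxtrace_ptracem h mxtrace1.
Qed.

Lemma ptracer_lin m n (I : Type) (r : seq I) (w : I -> C)
    (Z : I -> 'M[C]_(m * n)) :
  ptracer (\sum_(i <- r) w i *: Z i) = \sum_(i <- r) w i *: ptracer (Z i).
Proof.
apply/matrixP => x y; rewrite !mxE summxE.
under eq_bigr do rewrite summxE.
rewrite exchange_big /=; apply: eq_bigr => i _; rewrite !mxE mulr_sumr.
by apply: eq_bigr => k _; rewrite mxE.
Qed.

Lemma ptracem_lin m n p (I : Type) (r : seq I) (w : I -> C)
    (Z : I -> 'M[C]_(m * n * p)) :
  ptracem (\sum_(i <- r) w i *: Z i) = \sum_(i <- r) w i *: ptracem (Z i).
Proof.
apply/matrixP => x y; rewrite !mxE summxE.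
under eq_bigr do rewrite summxE.
rewrite exchange_big /=; apply: eq_bigr => i _; rewrite !mxE mulr_sumr.
by apply: eq_bigr => k _; rewrite mxE.
Qed.

Lemma tensmx_lin m n (I : Type) (r : seq I) (w : I -> C)
    (Z : I -> 'M[C]_m) (B : 'M[C]_n) :
  (\sum_(i <- r) w i *: Z i) *t B = \sum_(i <- r) w i *: (Z i *t B).
Proof.
apply/matrixP => x y; rewrite !mxE !summxE mulr_suml.
by apply: eq_bigr => i _; rewrite !mxE mulrA.
Qed.

Lemma psdmx_lin n (I : Type) (r : seq I) (w : I -> R) (Z : I -> 'M[C]_n) :
  (forall i, 0 <= w i) -> (forall i, psdmx (Z i)) ->
  psdmx (\sum_(i <- r) (w i)%:C *: Z i).
Proof.
move=> w0 Z0 v; rewrite mulmx_sumr mulmx_suml summxE sumr_ge0// => i _.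
by rewrite -scalemxAr -scalemxAl mxE mulr_ge0 ?lecR//; exact: Z0.
Qed.

Lemma comb_convex n (w : 'I_n -> R) (Z : 'I_n -> superop R dA dB) :
  (forall i, 0 <= w i) -> (forall i, comb (Z i)) -> \sum_i w i = 1 ->
  comb (\sum_i (w i)%:C *: Z i).
Proof.
move=> w0 Z0 w1; split.
- by apply: psdmx_lin => // i; case: (Z0 i).
- rewrite !ptracer_lin tensmx_lin; apply: eq_bigr => i _.
  by congr (_ *: _); case: (Z0 i).
- rewrite ptracer_lin ptracem_lin (eq_bigr (fun i => (w i)%:C *: 1%:M)).
    by rewrite -scaler_suml -rmorph_sum w1 scale1r.
  by move=> i _; case: (Z0 i) => _ _ ->.
Qed.

Lemma comb_cone n (w : 'I_n -> R) (Z : 'I_n -> superop R dA dB) :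
  (0 < n)%N -> (forall i, 0 <= w i) -> (forall i, comb (Z i)) ->
  exists2 Y, comb Y & \sum_i (w i)%:C *: Z i = (\sum_i w i)%:C *: Y.
Proof.
move=> n0 w0 Z0; set s := \sum_i w i.
have [s0|s_neq0] := eqVneq s 0.
  exists (Z (Ordinal n0)) => //; rewrite s0 scale0r big1// => i _.
  have /eqP := s0; rewrite psumr_eq0// => /allP/(_ i).
  by rewrite mem_index_enum => /(_ isT)/eqP ->; rewrite scale0r.
exists (\sum_i (s^-1 * w i)%:C *: Z i).
  apply: comb_convex => //; last by rewrite -mulr_sumr mulVf.
  by move=> i; rewrite mulr_ge0// invr_ge0 sumr_ge0.
rewrite scaler_sumr; apply: eq_bigr => i _.
by rewrite scalerA -rmorphM mulrA divff// mul1r.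
Qed.

Lemma virtual_comb_decomp (X : superop R dA dB) :
  virtual_comb X -> base_norm_set X !=set0.
Proof.
case=> n [a [Z [a1 Z0 ->]]].
have n0 : (0 < n)%N.
  by case: n a {Z Z0} a1 => // a /eqP; rewrite big_ord0 eq_sym oner_eq0.
have max_ge0 (b : R) : 0 <= Num.max b 0 by rewrite le_max lexx orbT.
have [Yp Yp0 Ypa] := comb_cone n0 (fun i => max_ge0 (a i)) Z0.
have [Ym Ym0 Yma] := comb_cone n0 (fun i => max_ge0 (- a i)) Z0.
exists (\sum_i Num.max (a i) 0 + \sum_i Num.max (- a i) 0).
exists (\sum_i Num.max (a i) 0), (\sum_i Num.max (- a i) 0), Yp, Ym.
split=> //; split=> //; rewrite ?sumr_ge0// => *; rewrite ?le_max ?lexx ?orbT//.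
rewrite -Ypa -Yma -sumrB; apply: eq_bigr => i _.
rewrite -scalerBl -rmorphB; congr (_%:C *: _).
by rewrite /Num.max; case: ifP; case: ifP; lra.
Qed.

End BaseNorm.

Section PsdBound.
Variable R : realType.
Local Notation C := R[i].

Lemma quad_form2 n (X : 'M[C]_n) (i j : 'I_n) (c : C) :
  let v : 'cV[C]_n := delta_mx i 0 + c *: delta_mx j 0 in
  (v^t* *m X *m v) 0 0 =
  X i i + c * X i j + Num.conj c * X j i + Num.conj c * c * X j j.
Proof.
move=> v.
have e (k l : 'I_n) : ((delta_mx 0 k : 'rV[C]_n) *m X *m (delta_mx l 0 : 'cV[C]_n)) 0 0 = X k l.
  by rewrite -rowE -colE !mxE.
have -> : v^t* = delta_mx 0 i + Num.conj c *: delta_mx 0 j.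
  apply/matrixP => a b.
  by rewrite !mxE rmorphD rmorphM /= !rmorph_nat !(andbC (b == _)).
rewrite /v !(mulmxDl, mulmxDr, =^~ scalemxAl, =^~ scalemxAr).
have eD (A B : 'M[C]_1) : (A + B) 0 0 = A 0 0 + B 0 0 by rewrite mxE.
have eZ d (A : 'M[C]_1) : (d *: A) 0 0 = d * A 0 0 by rewrite mxE.
by rewrite !(eD, eZ) (e i i) (e i j) (e j i) (e j j) mulrDr mulrA addrA.
Qed.

Lemma psdmx_form2 n (X : 'M[C]_n) (i j : 'I_n) (c : C) : psdmx X ->
  0 <= X i i + c * X i j + Num.conj c * X j i + Num.conj c * c * X j j.
Proof. by move=> X0; rewrite -quad_form2; exact: X0. Qed.

Lemma psdmx_diag n (X : 'M[C]_n) (i : 'I_n) : psdmx X -> 0 <= X i i.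
Proof. by move=> /(psdmx_form2 i i 0); rewrite rmorph0 !mul0r !addr0. Qed.

Lemma psdmx_bound n (X : 'M[C]_n) (i j : 'I_n) : psdmx X ->
  `|complex.Re (X i j)| <= complex.Re (\tr X) /\
  `|complex.Im (X i j)| <= complex.Re (\tr X).
Proof.
move=> X0.
have D k := psdmx_diag k X0.
have T k : complex.Re (X k k) <= complex.Re (\tr X).
  have : X k k <= \tr X by rewrite /mxtrace (bigD1 k)//= lerDl sumr_ge0.
  by rewrite lecE => /andP[].
have := conj (T i) (T j); move: (D i) (D j).
have := psdmx_form2 i j 1 X0.
have := psdmx_form2 i j (-1) X0.
have := psdmx_form2 i j (0 +i* 1) X0.
have := psdmx_form2 i j (0 -i* 1) X0.
move: (X i i) (X j j) (X i j) (X j i) (complex.Re (\tr X)).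
move=> [a a'] [b b'] [x x'] [y y'] t.
rewrite !lecE /= => /andP[/eqP h1 h2] /andP[/eqP h3 h4] /andP[/eqP h5 h6]
  /andP[/eqP h7 h8] /andP[/eqP h9 h10] /andP[/eqP h11 h12] [h13 h14].
by rewrite !ler_norml; split; apply/andP; split; lra.
Qed.

End PsdBound.

Section Continuity.
Variable R : realType.
Local Notation C := R[i].
Variable T : topologicalType.

Definition ccont (g : T -> C) : Prop :=
  continuous (fun t => complex.Re (g t) : R) /\ continuous (fun t => complex.Im (g t) : R).

Lemma ccont_cst c : ccont (fun=> c).
Proof. by split=> t; exact: cvg_cst. Qed.

Lemma ccontD f g : ccont f -> ccont g -> ccont (fun t => f t + g t).
Proof.
move=> [f1 f2] [g1 g2]; split.
  rewrite (_ : (fun t => _) = (fun t => complex.Re (f t) + complex.Re (g t))).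
    by move=> t; apply: cvgD; [exact: f1|exact: g1].
  by apply/funext => t; case: (f t) => ? ?; case: (g t).
rewrite (_ : (fun t => _) = (fun t => complex.Im (f t) + complex.Im (g t))).
  by move=> t; apply: cvgD; [exact: f2|exact: g2].
by apply/funext => t; case: (f t) => ? ?; case: (g t).
Qed.

Lemma ccontM f g : ccont f -> ccont g -> ccont (fun t => f t * g t).
Proof.
move=> [f1 f2] [g1 g2]; split.
  rewrite (_ : (fun t => _) = (fun t => complex.Re (f t) * complex.Re (g t) -
      complex.Im (f t) * complex.Im (g t))).
    move=> t; apply: cvgB; apply: cvgM;
      by [exact: f1|exact: f2|exact: g1|exact: g2].
  by apply/funext => t; case: (f t) => ? ?; case: (g t).
rewrite (_ : (fun t => _) = (fun t => complex.Re (f t) * complex.Im (g t) +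
    complex.Im (f t) * complex.Re (g t))).
  move=> t; apply: cvgD; apply: cvgM;
    by [exact: f1|exact: f2|exact: g1|exact: g2].
by apply/funext => t; case: (f t) => ? ?; case: (g t).
Qed.

Lemma ccont_sum (I : Type) (r : seq I) (f : I -> T -> C) :
  (forall i, ccont (f i)) -> ccont (fun t => \sum_(i <- r) f i t).
Proof.
move=> fc; elim: r => [|i r ih].
  by rewrite (_ : (fun t => _) = fun=> 0);
    [exact: ccont_cst|apply/funext => t; rewrite big_nil].
rewrite (_ : (fun t => _) = fun t => f i t + \sum_(i <- r) f i t).
  exact: ccontD.
by apply/funext => t; rewrite big_cons.
Qed.

Lemma closed_ccont_ge0 g : ccont g -> closed [set t | 0 <= g t].
Proof.
move=> [g1 g2].
rewrite (_ : mkset _ = ((fun t => complex.Im (g t)) @^-1` [set x | x = 0]) `&`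
  ((fun t => complex.Re (g t)) @^-1` [set x | 0 <= x])).
  apply: closedI; apply: preimage_closed.
  - by move=> t _; exact: g2.
  - exact: (@closed_eq _ 0).
  - by move=> t _; exact: g1.
  - exact: (@closed_ge _ 0).
apply/seteqP; split => t /=; rewrite lecE /=; first by move=> /andP[/eqP].
by move=> [-> ->]; rewrite eqxx.
Qed.

Definition mcont m n (F : T -> 'M[C]_(m, n)) : Prop :=
  forall i j, ccont (fun t => F t i j).

Lemma mcontM m n p (F : T -> 'M[C]_(m, n)) (G : T -> 'M[C]_(n, p)) :
  mcont F -> mcont G -> mcont (fun t => F t *m G t).
Proof.
move=> Fc Gc i j; under eq_fun do rewrite mxE.
by apply: ccont_sum => k; exact: ccontM.
Qed.

Lemma mcont_cst m n (A : 'M[C]_(m, n)) : mcont (fun=> A).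
Proof. by move=> i j; exact: ccont_cst. Qed.

Lemma mcontD m n (F G : T -> 'M[C]_(m, n)) :
  mcont F -> mcont G -> mcont (fun t => F t + G t).
Proof. by move=> Fc Gc i j; under eq_fun do rewrite mxE; exact: ccontD. Qed.

Lemma mcont_real n (f : T -> R) :
  continuous f -> mcont (fun t => (f t)%:C%:M : 'M[C]_n).
Proof.
move=> fc i j; under eq_fun do rewrite mxE.
case: eqVneq => _; last exact: ccont_cst.
by split => //=; exact: (ccont_cst 0).2.
Qed.

Lemma mcont_tens m n (F : T -> 'M[C]_m) (A : 'M[C]_n) :
  mcont F -> mcont (fun t => F t *t A).
Proof.
move=> Fc i j; under eq_fun do rewrite mxE.
by apply: ccontM => //; exact: ccont_cst.
Qed.

Lemma mcont_ptracer m n (F : T -> 'M[C]_(m * n)) :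
  mcont F -> mcont (fun t => ptracer (F t)).
Proof. by move=> Fc i j; under eq_fun do rewrite mxE; exact: ccont_sum. Qed.

Lemma mcont_ptracem m n p (F : T -> 'M[C]_(m * n * p)) :
  mcont F -> mcont (fun t => ptracem (F t)).
Proof. by move=> Fc i j; under eq_fun do rewrite mxE; exact: ccont_sum. Qed.

Lemma closed_mcont_eq m n (F G : T -> 'M[C]_(m, n)) :
  mcont F -> mcont G -> closed [set t | F t = G t].
Proof.
move=> Fc Gc.
rewrite (_ : mkset _ = \bigcap_(ij in [set: 'I_m * 'I_n])
   ([set t | 0 <= F t ij.1 ij.2 + (-1) * G t ij.1 ij.2] `&`
    [set t | 0 <= G t ij.1 ij.2 + (-1) * F t ij.1 ij.2])).
  apply: closed_bigI => ij _; apply: closedI; apply: closed_ccont_ge0;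
    by apply: ccontD => //; apply: ccontM => //; exact: ccont_cst.
apply/seteqP; split => t /=.
  by move=> e ij _; rewrite /= e mulN1r subrr.
move=> h; apply/matrixP => i j; have /= := h (i, j) I.
by rewrite !mulN1r !subr_ge0 => -[? ?]; apply/eqP; rewrite eq_le; apply/andP.
Qed.

Lemma closed_mcont_psd n (F : T -> 'M[C]_n) :
  mcont F -> closed [set t | psdmx (F t)].
Proof.
move=> Fc.
rewrite (_ : mkset _ = \bigcap_(v in [set: 'cV[C]_n])
   [set t | 0 <= (v^t* *m F t *m v) 0 0]).
  apply: closed_bigI => v _; apply: closed_ccont_ge0.
  apply: (mcontM (F := fun t => v^t* *m F t) (G := fun=> v)) => //.
    by apply: mcontM => //; exact: mcont_cst.
  exact: mcont_cst.
by apply/seteqP; split => t h v; [move=> _; exact: h|exact: (h v I)].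
Qed.

Lemma closed_mcont_comb dA dB (F : T -> superop R dA dB) :
  mcont F -> closed [set t | comb (F t)].
Proof.
move=> Fc.
rewrite (_ : mkset _ = [set t | psdmx (F t)] `&`
  ([set t | ptracer (F t) = ptracer (ptracer (F t)) *t (dB%:R^-1 *: 1%:M)] `&`
   [set t | ptracem (ptracer (F t)) = 1%:M])).
  apply: closedI; first exact: closed_mcont_psd.
  have c1 := mcont_ptracer Fc; have c2 := mcont_ptracer c1.
  apply: closedI; apply: closed_mcont_eq => //.
  - exact: mcont_tens.
  - exact: mcont_ptracem.
  - exact: mcont_cst.
by apply/seteqP; split => t; [case|case=> ? []].
Qed.

End Continuity.

Section Attained.
Variable R : realType.
Local Notation C := R[i].

Definition mk_mx n (t : 'rV[R]_(n * n) * 'rV[R]_(n * n)) : 'M[C]_n :=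
  \matrix_(i, j) (t.1 0 (mxvec_index i j) +i* t.2 0 (mxvec_index i j)).

Lemma mk_mx_surj n (X : 'M[C]_n) :
  X = mk_mx (mxvec (map_mx (@complex.Re R) X), mxvec (map_mx (@complex.Im R) X)).
Proof.
by apply/matrixP => i j; rewrite !mxE /= !mxvecE !mxE; case: (X i j).
Qed.

Lemma mcont_mk_mx n (T : topologicalType)
    (f : T -> 'rV[R]_(n * n) * 'rV[R]_(n * n)) :
  continuous f -> mcont (fun t => mk_mx (f t)).
Proof.
move=> fc i j; split.
  rewrite (_ : (fun t => _) = fun t => (f t).1 0 (mxvec_index i j)).
    move=> t; apply: (@continuous_comp _ _ _ (fun t => (f t).1)
      (fun M : 'rV[R]_(n * n) => M 0 (mxvec_index i j))).
      by apply: (@continuous_comp _ _ _ f fst); [exact: fc|exact: cvg_fst].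
    exact: coord_continuous.
  by apply/funext => t; rewrite mxE.
rewrite (_ : (fun t => _) = fun t => (f t).2 0 (mxvec_index i j)).
  move=> t; apply: (@continuous_comp _ _ _ (fun t => (f t).2)
    (fun M : 'rV[R]_(n * n) => M 0 (mxvec_index i j))).
    by apply: (@continuous_comp _ _ _ f snd); [exact: fc|exact: cvg_snd].
  exact: coord_continuous.
by apply/funext => t; rewrite mxE.
Qed.

Variables dA dB : nat.

Let n := (dA * dA * dB * dB)%N.

Lemma compact_comb :
  compact [set t : 'rV[R]_(n * n) * 'rV[R]_(n * n) |
            comb (dA := dA) (dB := dB) (mk_mx t)].
Proof.
pose M : R := (dA * dB)%:R.
pose K := [set v : 'rV[R]_(n * n) | forall i, `[- M, M]%classic (v ord0 i)].
have cK : compact K by apply: (@rV_compact _ _ (fun=> `[- M, M]%classic)) => i; exact: segment_compact.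
apply: (@subclosed_compact _ _ (K `*` K)); last 2 first.
- exact: (compact_setX cK cK).
- move=> t /= ct.
  have tr : complex.Re (\tr (mk_mx t)) = M.
    by rewrite (comb_tr ct) /M -(rmorph_nat (real_complex R)).
  case: ct => X0 _ _; split=> k /=; case/mxvec_indexP: k => i j;
  have := psdmx_bound i j X0; rewrite tr mxE /= => -[h1 h2];
  by rewrite in_itv /= -ler_norml.
- exact: (closed_mcont_comb (F := fun t => mk_mx t) (mcont_mk_mx (f := id) (fun _ => cvg_id))).
Qed.

Lemma base_norm_attained (X : superop R dA dB) :
  (0 < dA)%N -> (0 < dB)%N -> virtual_comb X ->
  base_norm_set X (base_norm X).
Proof.
move=> A0 B0 vX.
have trX : \tr X = (dA * dB)%:R.
  case: vX => m [a [Z [a1 Z0 ->]]].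
  rewrite raddf_sum /= (eq_bigr (fun i => (a i)%:C * (dA * dB)%:R)).
    by rewrite -mulr_suml -rmorph_sum a1 mul1r.
  by move=> i _; rewrite mxtraceZ comb_tr.
have ap_am ap am Xp Xm : comb_decomp X ap am Xp Xm -> ap = 1 + am.
  move=> [_ _ cp cm eX]; have := congr1 (@mxtrace _ _) eX.
  rewrite raddfB /= !mxtraceZ trX !comb_tr// -mulrBl -rmorphB /=.
  rewrite -[LHS]mul1r => /mulIf; rewrite pnatr_eq0 muln_eq0 !gtn_eqF// => /(_ isT).
  by move=> /(congr1 (@complex.Re R)) /= ?; lra.
have [_ [ap0 [am0 [Xp0 [Xm0 [d0 _]]]]]] := virtual_comb_decomp vX.
pose V := ('rV[R]_(n * n) * 'rV[R]_(n * n))%type.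
pose Kc : set V := [set t | comb (dA := dA) (dB := dB) (mk_mx t)].
pose K : set (V * V * R) := [set t | [/\ Kc t.1.1, Kc t.1.2, t.2 \in `[0, am0] &
  X = (1 + t.2)%:C%:M *m mk_mx t.1.1 + (- t.2)%:C%:M *m mk_mx t.1.2]].
have KP t : K t -> comb_decomp X (1 + t.2) t.2 (mk_mx t.1.1) (mk_mx t.1.2).
  case=> kp km; rewrite in_itv /= => /andP[t0 _] ->; split => //.
    by rewrite addr_ge0.
  by rewrite !mul_scalar_mx rmorphN scaleNr.
have PK am Xp Xm : am <= am0 -> comb_decomp X (1 + am) am Xp Xm ->
    exists2 t, K t & t.2 = am.
  move=> lam [_ am_ge0 cp cm eX].
  rewrite (mk_mx_surj Xp) in cp eX; rewrite (mk_mx_surj Xm) in cm eX.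
  eexists (_, _, am) => //; split; [exact: cp|exact: cm| | ].
    by rewrite in_itv /= am_ge0.
  by rewrite eX !mul_scalar_mx rmorphN scaleNr.
have K0 : K !=set0.
  move: d0 (d0); rewrite {1}/comb_decomp => + /[dup] /ap_am ->.
  by move=> _ /(PK _ _ _ (lexx _))[t]; exists t.
have cK : compact K.
  apply: (@subclosed_compact _ _ (Kc `*` Kc `*` `[0, am0]%classic)).
  - rewrite (_ : K = (Kc `*` Kc `*` `[0, am0]%classic) `&` [set t | X =
     (1 + t.2)%:C%:M *m mk_mx t.1.1 + (- t.2)%:C%:M *m mk_mx t.1.2]).
      apply: closedI.
        apply: compact_closed; first exact: norm_hausdorff.
        by apply: compact_setX; [apply: compact_setX; exact: compact_comb|exact: segment_compact].
      apply: closed_mcont_eq; first exact: mcont_cst.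
      apply: mcontD; apply: mcontM.
      - by apply: mcont_real => t; apply: cvgD; [exact: cvg_cst|exact: cvg_snd].
      - apply: mcont_mk_mx => t.
        by apply: (@continuous_comp _ _ _ fst fst); exact: cvg_fst.
      - by apply: mcont_real => t; apply: cvgN; exact: cvg_snd.
      - apply: mcont_mk_mx => t.
        by apply: (@continuous_comp _ _ _ fst snd); [exact: cvg_fst|exact: cvg_snd].
    by apply/seteqP; split => s; [case=> ? ? ? ->|case=> -[[? ?] ?] ?].
  - by apply: compact_setX; [apply: compact_setX; exact: compact_comb|exact: segment_compact].
  - by move=> t [? ? ? _].
have cs : {within K, continuous (fun t : V * V * R => t.2)}.
  by apply: continuous_subspaceT => t; exact: cvg_snd.
have [t tK tmin] := compact_EVT_min K0 cK cs.
have [_ _ + _] := set_mem tK; rewrite in_itv /= => /andP[_ tam0].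
have {}tK := KP _ (set_mem tK).
suff -> : base_norm X = 1 + t.2 + t.2.
  by exists (1 + t.2), t.2, (mk_mx t.1.1), (mk_mx t.1.2).
apply/eqP; rewrite eq_le; apply/andP; split.
  apply: ge_inf; last by exists (1 + t.2), t.2, (mk_mx t.1.1), (mk_mx t.1.2).
  by exists 0 => _ [ap [am [Xp [Xm [[? ? _ _ _] ->]]]]]; rewrite addr_ge0.
apply: lb_le_inf; first exact: virtual_comb_decomp.
move=> _ [ap [am [Xp [Xm [d ->]]]]]; have eap := ap_am _ _ _ _ d.
rewrite {}eap in d *.
suff : t.2 <= am by lra.
have [lam|/ltW lam] := leP am am0.
  by have [s /mem_set Ks <-] := PK _ _ _ lam d; exact: tmin.
exact: le_trans lam.
Qed.

End Attained.

Section Kraus.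
Variable R : realType.
Local Notation C := R[i].

Lemma psdmx_herm n (X : 'M[C]_n) i j : psdmx X -> X j i = Num.conj (X i j).
Proof.
move=> X0.
have D k := psdmx_diag k X0.
move: (D i) (D j).
have := psdmx_form2 i j 1 X0.
have := psdmx_form2 i j (0 +i* 1) X0.
move: (X i i) (X j j) (X i j) (X j i) => [a a'] [b b'] [x x'] [y y'].
rewrite !lecE /= => /andP[/eqP h1 h2] /andP[/eqP h3 h4] /andP[/eqP h5 h6]
  /andP[/eqP h7 h8].
by congr (_ +i* _); lra.
Qed.

Lemma quad_formE n (X : 'M[C]_n) (v : 'cV[C]_n) :
  (v^t* *m X *m v) 0 0 = \sum_x \sum_y Num.conj (v x 0) * X x y * v y 0.
Proof.
rewrite mxE exchange_big /=; apply: eq_bigr => y _.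
by rewrite mxE mulr_suml; apply: eq_bigr => x _; rewrite !mxE.
Qed.

Lemma psdmx_gram n (X : 'M[C]_n) : psdmx X ->
  exists Q : 'M[C]_n, forall x y, X x y = \sum_r Q r x * Num.conj (Q r y).
Proof.
move=> X0.
have hX : X^t* = X by apply/matrixP => i j; rewrite !mxE -psdmx_herm.
have nX : X \is normalmx by apply/normalmxP; rewrite hX.
have uP := spectral_unitarymx X.
set P := spectralmx X in uP; set d := spectral_diag X.
have eX : X = P^t* *m diag_mx d *m P.
  by rewrite -(invmx_unitary uP) -(orthomx_spectralP nX).
have PP : P *m P^t* = 1%:M by apply/unitarymxP.
have d0 r : 0 <= d 0 r.
  have PXP : P *m X *m P^t* = diag_mx d.
    by rewrite eX !mulmxA PP mul1mx -mulmxA PP mulmx1.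
  have := X0 (P^t* *m delta_mx r 0).
  rewrite trmx_mul map_mxM trmxCK.
  have -> : (delta_mx r 0 : 'cV[C]_n)^t* = delta_mx 0 r.
    by apply/matrixP => x y; rewrite !mxE rmorph_nat andbC.
  have -> : (delta_mx 0 r : 'rV[C]_n) *m P *m X *m (P^t* *m (delta_mx r 0 : 'cV[C]_n)) =
      delta_mx 0 r *m (P *m X *m P^t*) *m (delta_mx r 0 : 'cV[C]_n) by rewrite !mulmxA.
  by rewrite PXP -rowE -colE !mxE eqxx mulr1n.
exists (\matrix_(r, x) (sqrtC (d 0 r) * Num.conj (P r x))) => // x y.
rewrite {1}eX mxE; apply: eq_bigr => r _.
rewrite mul_mx_diag !mxE.
rewrite rmorphM /= conjCK.
rewrite (_ : Num.conj (sqrtC (d 0 r)) = sqrtC (d 0 r)).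
  by rewrite -[in LHS](sqrtCK (d 0 r)); ring.
by apply: conj_Creal; apply: ger0_real; rewrite sqrtC_ge0.
Qed.

Variables dA dB : nat.

Lemma cp_choi_psd (N : 'M[C]_dA -> 'M[C]_dB) :
  completely_positive N -> psdmx (choi N).
Proof.
pose w (x : 'I_(dA * dA)) : C := ((mxtens_unindex x).1 == (mxtens_unindex x).2)%:R.
move=> /(_ dA (\matrix_(x, y) (w x * w y))).
have -> : tens_id N (\matrix_(x, y) (w x * w y)) = choi N.
  apply: eq_bigr => i _; apply: eq_bigr => j _; congr (_ *t N _).
  apply/matrixP => a b; rewrite !mxE /w !mxtens_indexK /=.
  by rewrite -natrM mulnb (eq_sym a) (eq_sym b).
apply => v; rewrite quad_formE.
have -> : \sum_x \sum_y Num.conj (v x 0) * (\matrix_(x, y) (w x * w y)) x y * v y 0 =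
   Num.conj (\sum_x w x * v x 0) * (\sum_x w x * v x 0).
  rewrite rmorph_sum mulr_suml; apply: eq_bigr => x _.
  rewrite mulr_sumr; apply: eq_bigr => y _; rewrite mxE rmorphM rmorph_nat -/(w x).
  by ring.
by rewrite mulrC mul_conjC_ge0.
Qed.

Lemma cp_conj_map (N : {linear 'M[C]_dA -> 'M[C]_dB}) :
  completely_positive N -> exists N' : 'M[C]_dA -> 'M[C]_dB, is_conj_map N N'.
Proof.
move=> /cp_choi_psd/psdmx_gram[Q eQ].
pose K r : 'M[C]_(dB, dA) := \matrix_(k, i) Q r (mxtens_index (i, k)).
exists (fun X => \sum_r map_mx Num.conj (K r) *m X *m (K r)^T), _, K; split=> // X.
rewrite -choiK; apply/matrixP => k l; rewrite of_choiE summxE.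
under eq_bigr do under eq_bigr do rewrite eQ mulr_sumr.
under eq_bigr do rewrite exchange_big.
rewrite exchange_big; apply: eq_bigr => r _; rewrite mxE exchange_big.
apply: eq_bigr => j _; rewrite mxE mulr_suml; apply: eq_bigr => i _.
by rewrite !mxE; ring.
Qed.

Lemma choi_conj_map (N N' : 'M[C]_dA -> 'M[C]_dB) :
  is_conj_map N N' -> choi N' = (choi N)^T.
Proof.
case=> r [K [eN eN']]; apply/matrixP => x y; rewrite [RHS]mxE.
case: (mxtens_indexP x) => i k; case: (mxtens_indexP y) => j l.
rewrite !choiE eN eN' !summxE; apply: eq_bigr => s _.
rewrite -(mul_delta_mx (0 : 'I_1)) -(mul_delta_mx (0 : 'I_1) j i) !mulmxA -!colE -!mulmxA.
rewrite -!rowE !mxE !big_ord1 !mxE. ring.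
Qed.
End Kraus.

Section ExtAB.
Variable R : realType.
Local Notation C := R[i].
Variables dA dB : nat.

Let ix4 (a' a : 'I_dA) (b b' : 'I_dB) : 'I_(dA * dA * dB * dB) :=
  mxtens_index (mxtens_index (mxtens_index (a', a), b), b').

Lemma ext_ABE (J : 'M[C]_(dA * dB)) a' a b b' c' c d d' :
  ext_AB J (ix4 a' a b b') (ix4 c' c d d') =
  (a' == c')%:R * J (mxtens_index (a, b)) (mxtens_index (c, d)) *
  (b' == d')%:R.
Proof.
have ixE x' x y y' : cast_ord (esym (reassoc dA dB)) (ix4 x' x y y') =
    mxtens_index (mxtens_index (x', mxtens_index (x, y)), y').
  by apply: val_inj => /=; rewrite !mulnDl !mulnA !addnA.
by rewrite /ext_AB castmxE !ixE !tensmxE !mxE.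
Qed.

End ExtAB.

(* Main.v *)
(* Let F_A and F_B be the swaps of A', A and of B', B. The operator F_A F_B
   transposes every Choi operator; on channels, for which Tr_B J = 1_A, adding a
   multiple of (1 / dA - F_A) (x) 1_BB' changes nothing. The multiple
   dA / (dA + 1) minimizes the trace of the negative part, which gives the upper
   bound. For the lower bound, the Choi operators of channels span all J with
   Tr_B J a multiple of 1_A, so that conjugating channels fixes tr (Y X) for the
   dual solution Y, whereas 0 <= Y <= 1 bounds tr (Y C) for every comb C. *)
Require Import Defs.
From HB Require Import structures.
Set Warnings "-notation-overridden,-ambiguous-paths,-notation-incompatible-prefix".
From mathcomp Require Import all_boot all_order all_algebra.
From mathcomp Require Import all_classical all_reals all_analysis.
From mathcomp Require Import complex mxtens.
From mathcomp Require Import zify ring lra.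
Set Implicit Arguments.
Unset Strict Implicit.
Unset Printing Implicit Defensive.
Import Order.TTheory GRing.Theory Num.Theory.
Import numFieldNormedType.Exports.
Local Open Scope ring_scope.

(** * Positive semidefinite matrices and the trace pairing *)

Section Psd.
Variable R : realType.
Local Notation C := R[i].
Local Open Scope sesquilinear_scope.

(** All combs have trace [dA * dB], so [ap - am = 1] in every decomposition and only the least [am]
    is sought. The obstacle is that the action on channels determines X only up to terms Z (x) 1_B
    with Z on A'AB' and Tr_A Z = 0, and the lower bound must hold for all of them. Primal and dual
    solutions both lie in the span of 1, F_A, F_B and F_A F_B, where positivity is a matter of four
    eigenvalues. Let P+ and P- be the symmetric and antisymmetric projections. The multiple dA / (dA
    + 1) is the one at which the eigenvalue on P- (x) P+ vanishes, and complementary slackness then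
    leaves Y free to take there any value between 0 and 1. The value (dB - 1)/(dB + 1) makes Tr_B Y
    a multiple of the identity, because Tr_B P+ = (dB + 1)/2 and Tr_B P- = (dB - 1)/2; hence tr (Y
    X) does not see Z. *)

Lemma psdmx_sum_outer (n : nat) (I : finType) (q : I -> 'I_n -> C) :
  psdmx (\matrix_(x, y) \sum_r q r x * Num.conj (q r y)).
Proof.
move=> v; rewrite quad_formE.
suff -> : \sum_x \sum_y Num.conj (v x 0) *
    (\matrix_(x, y) \sum_r q r x * Num.conj (q r y)) x y * v y 0 =
    \sum_r (\sum_x Num.conj (v x 0) * q r x) *
      Num.conj (\sum_x Num.conj (v x 0) * q r x).
  by apply: sumr_ge0 => r _; exact: mul_conjC_ge0.
under eq_bigr do under eq_bigr do rewrite mxE mulr_sumr mulr_suml.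
under eq_bigr do rewrite exchange_big.
rewrite exchange_big; apply: eq_bigr => r _ /=.
rewrite rmorph_sum mulr_suml; apply: eq_bigr => x _.
rewrite mulr_sumr; apply: eq_bigr => y _.
by rewrite rmorphM /= conjCK; ring.
Qed.

Lemma psdmxD n (X Y : 'M[C]_n) : psdmx X -> psdmx Y -> psdmx (X + Y).
Proof.
by move=> X0 Y0 v; rewrite mulmxDr mulmxDl mxE addr_ge0.
Qed.

Lemma psdmxZ n (c : C) (X : 'M[C]_n) : 0 <= c -> psdmx X -> psdmx (c *: X).
Proof.
by move=> c0 X0 v; rewrite -scalemxAr -scalemxAl mxE mulr_ge0.
Qed.

Lemma psdmx1 n : psdmx (1%:M : 'M[C]_n).
Proof.
move=> v; rewrite mulmx1 mxE sumr_ge0 // => x _.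
by rewrite !mxE mulrC mul_conjC_ge0.
Qed.

Lemma psdmx_tr_ge0 n (X : 'M[C]_n) : psdmx X -> 0 <= \tr X.
Proof. by move=> X0; apply: sumr_ge0 => x _; exact: psdmx_diag. Qed.

Lemma psdmx_trM_ge0 n (X Y : 'M[C]_n) : psdmx X -> psdmx Y -> 0 <= \tr (X *m Y).
Proof.
move=> X0 /psdmx_gram[Q eY].
suff -> : \tr (X *m Y) = \sum_r ((\col_x Q r x)^t* *m X *m (\col_x Q r x)) 0 0.
  by apply: sumr_ge0 => r _; exact: X0.
under [RHS]eq_bigr do rewrite quad_formE.
rewrite exchange_big; apply: eq_bigr => x _; rewrite mxE exchange_big.
apply: eq_bigr => y _; rewrite eY mulr_sumr; apply: eq_bigr => r _.
by rewrite !mxE; ring.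
Qed.

Lemma psdmx_le_trace n (T : 'M[C]_n) : psdmx T -> psdmx ((\tr T)%:M - T).
Proof.
move=> /psdmx_gram[Q eT] v.
suff -> : (v^t* *m ((\tr T)%:M - T) *m v) 0 0 =
   2^-1 * \sum_r \sum_x \sum_y (Q r x * v y 0 - Q r y * v x 0) *
     Num.conj (Q r x * v y 0 - Q r y * v x 0).
  rewrite mulr_ge0 ?invr_ge0 ?ler0n //; apply: sumr_ge0 => r _.
  by do 2! (apply: sumr_ge0 => ? _); exact: mul_conjC_ge0.
rewrite mulmxBr mulmxBl [LHS]mxE [X in _ + X]mxE (quad_formE T) mul_mx_scalar.
rewrite -scalemxAl [X in X - _]mxE [X in _ * X - _]mxE /mxtrace.
pose f r x y := Q r x * Num.conj (Q r x) * (Num.conj (v y 0) * v y 0).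
pose g r x y := Num.conj (v x 0) * (Q r x * Num.conj (Q r y)) * v y 0.
have -> : (\sum_x T x x) * (\sum_y v^t* 0 y * v y 0) =
    \sum_r \sum_x \sum_y f r x y.
  rewrite mulr_suml [RHS]exchange_big; apply: eq_bigr => x _ /=.
  rewrite eT mulr_suml; apply: eq_bigr => r _.
  by rewrite mulr_sumr; apply: eq_bigr => y _; rewrite !mxE.
have -> : \sum_x \sum_y Num.conj (v x 0) * T x y * v y 0 =
    \sum_r \sum_x \sum_y g r x y.
  rewrite [RHS]exchange_big; apply: eq_bigr => x _ /=.
  rewrite [RHS]exchange_big; apply: eq_bigr => y _ /=.
  by rewrite eT mulr_sumr mulr_suml.
rewrite -sumrB mulr_sumr; apply: eq_bigr => r _.
have -> : \sum_x \sum_y (Q r x * v y 0 - Q r y * v x 0) *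
     Num.conj (Q r x * v y 0 - Q r y * v x 0) =
   \sum_x \sum_y (f r x y + f r y x - g r x y - g r y x).
  apply: eq_bigr => x _; apply: eq_bigr => y _.
  by rewrite rmorphB !rmorphM /f /g /=; ring.
under [in RHS]eq_bigr do rewrite !sumrB big_split.
rewrite !sumrB big_split /= [X in _ + X - _ - _]exchange_big /=.
rewrite [X in _ - X]exchange_big /=.
by field.
Qed.

(** Polarization: the vectors e_i + c e_j with c = 1 and c = i give H_ij + H_ji = 0 and H_ij - H_ji
    = 0. *)
Lemma quad_form_eq0 n (H : 'M[C]_n) :
  (forall v : 'cV[C]_n, (v^t* *m H *m v) 0 0 = 0) -> H = 0.
Proof.
move=> H0; apply/matrixP => i j; rewrite [RHS]mxE.
have q k l c := etrans (esym (quad_form2 H k l c)) (H0 _).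
have D k : H k k = 0.
  by have := q k k 0; rewrite rmorph0 !mul0r !addr0.
have := q i j 1; have := q i j 'i%C.
rewrite !D complexiE conjCi rmorph1 !mulr0 !addr0 !add0r !mul1r.
rewrite mulNr -mulrBr => /eqP; rewrite mulf_eq0 (negbTE (neq0Ci _)) /= subr_eq0.
move=> /eqP <- /eqP; rewrite -mulr2n mulrn_eq0 /= => /eqP //.
Qed.

Lemma psdmx_trM_eq0 n (H : 'M[C]_n) :
  (forall K : 'M[C]_n, psdmx K -> \tr (H *m K) = 0) -> H = 0.
Proof.
move=> H0; apply: quad_form_eq0 => v.
have K0 := psdmx_sum_outer (fun (_ : 'I_1) x => v x 0).
rewrite -[RHS](H0 _ K0) quad_formE; apply: eq_bigr => x _; rewrite mxE.
by apply: eq_bigr => y _; rewrite mxE big_ord1; ring.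
Qed.

End Psd.

(** * Partial traces and the operators orthogonal to all channels *)

Section PartialTrace.
Variable R : realType.
Local Notation C := R[i].
Local Open Scope sesquilinear_scope.

Lemma sum_mxtens (V : nmodType) m n (f : 'I_(m * n) -> V) :
  \sum_x f x = \sum_i \sum_j f (mxtens_index (i, j)).
Proof.
rewrite pair_big /= (reindex (@mxtens_index m n)) /=; last first.
  by exists (@mxtens_unindex m n) => x _;
    [exact: mxtens_indexK|exact: mxtens_unindexK].
by apply: eq_bigr => -[].
Qed.

Lemma ptracerD m n (X Y : 'M[C]_(m * n)) :
  ptracer (X + Y) = ptracer X + ptracer Y.
Proof.
by apply/matrixP => i j; rewrite !mxE -big_split; apply: eq_bigr => k _; rewrite mxE.
Qed.

Lemma ptracerZ m n c (X : 'M[C]_(m * n)) : ptracer (c *: X) = c *: ptracer X.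
Proof.
by apply/matrixP => i j; rewrite !mxE mulr_sumr; apply: eq_bigr => k _; rewrite mxE.
Qed.

Lemma ptracer_tens m n (X : 'M[C]_m) (Y : 'M[C]_n) :
  ptracer (X *t Y) = \tr Y *: X.
Proof.
apply/matrixP => i j; rewrite !mxE mulr_suml; apply: eq_bigr => k _.
by rewrite tensmxE mulrC.
Qed.

Lemma tensmxZr m n c (X : 'M[C]_m) (Y : 'M[C]_n) :
  X *t (c *: Y) = c *: (X *t Y).
Proof.
apply/matrixP => x y; case: (mxtens_indexP x) => i k.
by case: (mxtens_indexP y) => j l; rewrite [RHS]mxE !tensmxE mxE mulrCA.
Qed.

Lemma mxtrace_mul_tens1 m n (H : 'M[C]_(m * n)) (M : 'M[C]_m) :
  \tr (H *m (M *t 1%:M)) = \tr (ptracer H *m M).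
Proof.
rewrite /mxtrace sum_mxtens; apply: eq_bigr => i _.
under eq_bigr do rewrite mxE sum_mxtens.
rewrite exchange_big /= mxE; apply: eq_bigr => j _.
rewrite mxE mulr_suml; apply: eq_bigr => k _.
rewrite (bigD1 k) //= tensmxE mxE eqxx mulr1 big1 ?addr0 // => l lk.
by rewrite tensmxE [1%:M _ _]mxE (negbTE lk) !mulr0.
Qed.

Lemma psdmx_ptracer m n (X : 'M[C]_(m * n)) : psdmx X -> psdmx (ptracer X).
Proof.
move=> /psdmx_gram[Q eX].
suff -> : ptracer X = \matrix_(i, j) \sum_(rk : 'I_(m * n) * 'I_n)
    Q rk.1 (mxtens_index (i, rk.2)) * Num.conj (Q rk.1 (mxtens_index (j, rk.2))).
  exact: psdmx_sum_outer.
apply/matrixP => i j; rewrite !mxE.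
rewrite -(pair_big xpredT xpredT (fun r k => Q r (mxtens_index (i, k)) *
  Num.conj (Q r (mxtens_index (j, k))))) /= exchange_big.
by apply: eq_bigr => k _; rewrite eX.
Qed.

Lemma psdmx_tens m n (X : 'M[C]_m) (Y : 'M[C]_n) :
  psdmx X -> psdmx Y -> psdmx (X *t Y).
Proof.
move=> /psdmx_gram[P eX] /psdmx_gram[Q eY].
suff -> : X *t Y = \matrix_(x, y) \sum_(rs : 'I_m * 'I_n)
    (P rs.1 (mxtens_unindex x).1 * Q rs.2 (mxtens_unindex x).2) *
    Num.conj (P rs.1 (mxtens_unindex y).1 * Q rs.2 (mxtens_unindex y).2).
  exact: (psdmx_sum_outer (fun (rs : 'I_m * 'I_n) x =>
    P rs.1 (mxtens_unindex x).1 * Q rs.2 (mxtens_unindex x).2)).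
apply/matrixP => x y; rewrite !mxE eX eY mulr_suml.
rewrite -(pair_big xpredT xpredT (fun r s =>
  (P r (mxtens_unindex x).1 * Q s (mxtens_unindex x).2) *
  Num.conj (P r (mxtens_unindex y).1 * Q s (mxtens_unindex y).2))) /=.
apply: eq_bigr => r _; rewrite mulr_sumr; apply: eq_bigr => s _.
by rewrite rmorphM /=; ring.
Qed.

(* A positive K is completed to a multiple of a channel by adding
   ((1 + tr K) 1 - Tr_B K) (x) 1_B / dB; positive K span all matrices. *)
Lemma orth_choi_channels dA dB (H : 'M[C]_(dA * dB)) : (0 < dB)%N ->
  (forall J : 'M[C]_(dA * dB), psdmx J -> ptracer J = 1%:M -> \tr (H *m J) = 0) ->
  H = ptracer H *t (dB%:R^-1 *: 1%:M).
Proof.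
move=> dB0 H0; apply/eqP; rewrite -subr_eq0; apply/eqP.
have dBn : dB%:R != 0 :> C by rewrite pnatr_eq0 -lt0n.
have dBV : 0 <= dB%:R^-1 :> C by rewrite invr_ge0 ler0n.
(* Tested on the completely depolarizing channel, with Choi operator 1 (x) 1 / dB. *)
have trpH : \tr (ptracer H) = 0.
  have := H0 (dB%:R^-1 *: (1%:M *t 1%:M)).
  rewrite ptracerZ ptracer_tens mxtrace1 scalerA mulVf // scale1r.
  move=> /(_ (psdmxZ dBV (psdmx_tens (@psdmx1 _ _) (@psdmx1 _ _))) erefl).
  rewrite -scalemxAr mxtraceZ mxtrace_mul_tens1 mulmx1 => /eqP.
  by rewrite mulf_eq0 invr_eq0 (negbTE dBn) => /eqP.
apply: psdmx_trM_eq0 => K K0.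
set T := ptracer K; pose t : C := \tr T.
have T0 : psdmx T by exact: psdmx_ptracer.
have t0 : 0 <= t by exact: psdmx_tr_ge0.
have t1 : 1 + t != 0 by rewrite gt_eqF // ltr_pwDl.
pose M : 'M[C]_dA := 1%:M + (t%:M - T).
have M0 : psdmx M by apply: psdmxD; [exact: psdmx1|exact: psdmx_le_trace].
have := H0 ((1 + t)^-1 *: (K + dB%:R^-1 *: (M *t 1%:M))).
have -> : ptracer ((1 + t)^-1 *: (K + dB%:R^-1 *: (M *t 1%:M))) = 1%:M.
  rewrite ptracerZ ptracerD ptracerZ ptracer_tens mxtrace1 (scalerA dB%:R^-1) mulVf //.
  have -> : ptracer K + 1 *: M = (1 + t) *: 1%:M.
    by rewrite scale1r scalerDl scale1r scalemx1 addrCA subrKC.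
  by rewrite scalerA mulVf // scale1r.
have J0 : psdmx ((1 + t)^-1 *: (K + dB%:R^-1 *: (M *t 1%:M))).
  apply: psdmxZ; first by rewrite invr_ge0 addr_ge0.
  by apply: psdmxD => //; apply: psdmxZ => //; apply: psdmx_tens => //; exact: psdmx1.
move=> /(_ J0 erefl).
rewrite -scalemxAr mxtraceZ => /eqP.
rewrite mulf_eq0 invr_eq0 (negbTE t1) /= mulmxDr -scalemxAr mxtraceD mxtraceZ.
(* Since [ptracer H] is traceless, only the term [- T] of [M] contributes, which leaves tr (H K) =
   tr (ptracer H T) / dB. *)
rewrite mxtrace_mul_tens1 /M !(mulmxDr, mulmxN, mulmx1, mul_mx_scalar).
rewrite !(mxtraceD, mxtraceZ, raddfN) /= trpH mulr0 !add0r mulrN => /eqP e.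
rewrite mulmxBl mxtraceD raddfN /= tensmxZr -scalemxAl mxtraceZ (mxtrace_mulC (_ *t _)).
by rewrite mxtrace_mul_tens1 (mxtrace_mulC _ (ptracer H)).
Qed.
End PartialTrace.

(** * Conjugation of channels as an equation between Choi operators *)

Section Conjugation.
Variable R : realType.
Local Notation C := R[i].
Variables dA dB : nat.
Local Open Scope sesquilinear_scope.

Definition ix4 (a' a : 'I_dA) (b b' : 'I_dB) : 'I_(dA * dA * dB * dB) :=
  mxtens_index (mxtens_index (mxtens_index (a', a), b), b').

Lemma sum_ix4 (V : nmodType) (f : 'I_(dA * dA * dB * dB) -> V) :
  \sum_x f x = \sum_a' \sum_a \sum_b \sum_b' f (ix4 a' a b b').
Proof. by rewrite sum_mxtens sum_mxtens sum_mxtens. Qed.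

(** The transpose of [J] compensates the index exchange of the matrix product, so the entries of X
    and [J] are paired without any exchange. *)
Lemma ptrace_ABE (X : superop R dA dB) (J : 'M[C]_(dA * dB)) a' b' c' d' :
  ptrace_AB (X *m ext_AB J^T) (mxtens_index (a', b')) (mxtens_index (c', d')) =
  \sum_a \sum_b \sum_c \sum_d
    X (ix4 a' a b b') (ix4 c' c d d') *
    J (mxtens_index (a, b)) (mxtens_index (c, d)).
Proof.
rewrite /ptrace_AB mxE; apply: eq_bigr => a _; rewrite !mxtens_indexK /=.
rewrite mxE; apply: eq_bigr => b _; rewrite !mxtens_indexK /=.
rewrite mxE sum_ix4 (bigD1 c') //= [X in _ + X]big1 ?addr0; last first.
  move=> x xc'; do 3! (rewrite big1 // => ? _).
  by rewrite ext_ABE (negbTE xc') !mul0r mulr0.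
apply: eq_bigr => c _; apply: eq_bigr => d _.
rewrite (bigD1 d') //= [X in _ + X]big1 ?addr0; last first.
  by move=> x xd'; rewrite ext_ABE (negbTE xd') !mulr0.
by rewrite ext_ABE !eqxx mul1r mulr1 mxE.
Qed.

Lemma linear_of_choi (J : 'M[C]_(dA * dB)) : linear (of_choi J).
Proof.
move=> c X Y; apply/matrixP => k l; rewrite !(of_choiE, mxE) mulr_sumr -big_split.
apply: eq_bigr => i _ /=; rewrite mulr_sumr -big_split; apply: eq_bigr => j _ /=.
by rewrite !mxE mulrDl mulrA.
Qed.

HB.instance Definition _ (J : 'M[C]_(dA * dB)) :=
  GRing.isLinear.Build C 'M[C]_dA 'M[C]_dB *:%R (of_choi J) (linear_of_choi J).

Lemma cptp_of_choi (J : 'M[C]_(dA * dB)) :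
  psdmx J -> ptracer J = 1%:M -> cptp (of_choi J).
Proof.
move=> J0 J1; split; last first.
  move=> X; rewrite {1}/mxtrace; under eq_bigr do rewrite of_choiE.
  rewrite exchange_big; apply: eq_bigr => i _ /=.
  rewrite exchange_big (bigD1 i) //= [X in _ + X]big1 => [|j ji].
    rewrite addr0 -mulr_sumr; move/matrixP/(_ i i): J1.
    by rewrite !mxE eqxx => ->; rewrite mulr1.
  rewrite -mulr_sumr; move/matrixP/(_ i j): J1.
  by rewrite !mxE eq_sym (negbTE ji) => ->; rewrite mulr0.
move=> k X /psdmx_gram[P eX]; have [Q eJ] := psdmx_gram J0.
(* Row s of [Q], read as a dB-by-dA matrix, is a Kraus operator; applied to row r of [P] it gives
   the Gram row of index (r, s). *)
suff -> : tens_id (of_choi J) X = \matrix_(x, y) \sum_(rs : _ * _)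
   (\sum_a P rs.1 (mxtens_index ((mxtens_unindex x).1, a)) *
      Q rs.2 (mxtens_index (a, (mxtens_unindex x).2))) *
   Num.conj (\sum_a P rs.1 (mxtens_index ((mxtens_unindex y).1, a)) *
      Q rs.2 (mxtens_index (a, (mxtens_unindex y).2))).
  exact: (psdmx_sum_outer (fun rs x =>
    \sum_a P rs.1 (mxtens_index ((mxtens_unindex x).1, a)) *
      Q rs.2 (mxtens_index (a, (mxtens_unindex x).2)))).
apply/matrixP => x y; case: (mxtens_indexP x) => i u.
case: (mxtens_indexP y) => j v; rewrite [RHS]mxE !mxtens_indexK /=.
have -> : tens_id (of_choi J) X (mxtens_index (i, u)) (mxtens_index (j, v)) =
    \sum_a \sum_b X (mxtens_index (i, a)) (mxtens_index (j, b)) *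
      J (mxtens_index (a, u)) (mxtens_index (b, v)).
  rewrite /tens_id summxE (bigD1 i) //= [X in _ + X]big1 => [|i' ii']; last first.
    rewrite summxE big1 // => j' _.
    by rewrite tensmxE mxE eq_sym (negbTE ii') mul0r.
  rewrite addr0 summxE (bigD1 j) //= [X in _ + X]big1 => [|j' jj']; last first.
    by rewrite tensmxE mxE (eq_sym j) (negbTE jj') andbF mul0r.
  rewrite addr0 tensmxE mxE !eqxx mul1r of_choiE.
  by apply: eq_bigr => a _; apply: eq_bigr => b _; rewrite mxE.
under [LHS]eq_bigr do under eq_bigr do rewrite eX eJ big_distrlr pair_big /=.
under [LHS]eq_bigr do rewrite exchange_big /=.
rewrite exchange_big; apply: eq_bigr => rs _ /=.
rewrite rmorph_sum big_distrlr; apply: eq_bigr => a _; apply: eq_bigr => b _ /=.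
by rewrite rmorphM /=; ring.
Qed.

Lemma conjugates_channels_choi (X : superop R dA dB) (J : 'M[C]_(dA * dB)) :
  conjugates_channels X -> psdmx J -> ptracer J = 1%:M ->
  ptrace_AB (X *m ext_AB J^T) = J^T.
Proof.
move=> cX J0 J1; have NJ := cptp_of_choi J0 J1.
have [N' cN'] := cp_conj_map NJ.1.
rewrite -[RHS](congr1 trmx (of_choiK J)) -(choi_conj_map cN').
have -> : N' = supermap_app X (of_choi J).
  by apply/boolp.funext => Y; rewrite (cX _ NJ _ cN').
by rewrite /supermap_app !of_choiK.
Qed.

Lemma is_conj_map_of_choi (N N' : 'M[C]_dA -> 'M[C]_dB) :
  is_conj_map N N' -> N' =1 of_choi (choi N)^T.
Proof.
move=> cN Y; rewrite -(choi_conj_map cN).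
case: cN => r [K [_ eN']].
(* [is_conj_map] takes a bare function; the Kraus form supplies the linearity that [choiK] asks
   for. *)
have lin : linear N'.
  move=> c A B; rewrite !eN' scaler_sumr -big_split; apply: eq_bigr => j _ /=.
  by rewrite mulmxDr mulmxDl -scalemxAr -scalemxAl.
pose N'L : {linear 'M[C]_dA -> 'M[C]_dB} := HB.pack N'
  (GRing.isLinear.Build C 'M[C]_dA 'M[C]_dB *:%R N' lin).
by rewrite (choiK N'L).
Qed.

Lemma ptracer_choi (N : 'M[C]_dA -> 'M[C]_dB) :
  trace_preserving N -> ptracer (choi N) = 1%:M.
Proof.
move=> tN; apply/matrixP => i j; rewrite !mxE.
under eq_bigr do rewrite choiE.
rewrite -/(mxtrace _) tN /mxtrace (bigD1 i) //= big1 => [|k ki].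
  by rewrite addr0 mxE eqxx.
by rewrite mxE (negbTE ki).
Qed.

Lemma conjugates_channelsP (X : superop R dA dB) :
  (forall J : 'M[C]_(dA * dB), ptracer J = 1%:M ->
    ptrace_AB (X *m ext_AB J^T) = J^T) ->
  conjugates_channels X.
Proof.
move=> hX N [_ tN] N' cN Y; rewrite (is_conj_map_of_choi cN).
by rewrite /supermap_app hX // ptracer_choi.
Qed.

End Conjugation.

(** * Commuting involutions, their joint eigenprojections and the dual functional *)

Section CommutingInvolutions.
Variable C : numClosedFieldType.
Local Open Scope sesquilinear_scope.

(** Column y is the basis vector of index [f y], so that products of matrices follow composition of
    functions. *)
Definition fun_mx n (f : 'I_n -> 'I_n) : 'M[C]_n := \matrix_(x, y) (x == f y)%:R.

Lemma mul_fun_mx n (f g : 'I_n -> 'I_n) : fun_mx f *m fun_mx g = fun_mx (f \o g).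
Proof.
apply/matrixP => x y; rewrite !mxE (bigD1 (g y)) //= big1 => [|z zy].
  by rewrite !mxE eqxx mulr1 addr0.
by rewrite !mxE (negbTE zy) mulr0.
Qed.

Lemma fun_mx_invol n (f : 'I_n -> 'I_n) : involutive f -> fun_mx f *m fun_mx f = 1%:M.
Proof. by move=> fK; apply/matrixP => x y; rewrite mul_fun_mx !mxE /= fK. Qed.

Lemma adj_fun_mx n (f : 'I_n -> 'I_n) : involutive f -> (fun_mx f)^t* = fun_mx f.
Proof.
move=> fK; apply/matrixP => x y; rewrite !mxE rmorph_nat; congr (_%:R).
by congr nat_of_bool; apply/eqP/eqP => ->; rewrite fK.
Qed.

Lemma mxtrace_mul_fun_mx n (X : 'M[C]_n) f : \tr (X *m fun_mx f) = \sum_x X x (f x).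
Proof.
apply: eq_bigr => x _; rewrite mxE (bigD1 (f x)) //= big1 => [|z zx].
  by rewrite mxE eqxx mulr1 addr0.
by rewrite mxE (negbTE zx) mulr0.
Qed.

Variables (n : nat) (f g : 'I_n -> 'I_n).
Local Notation F := (fun_mx f).
Local Notation G := (fun_mx g).

(* For commuting involutions f and g and for s, t = 1 or -1, four times the
   projection onto their common eigenspace with eigenvalues s and t. *)
Definition eigenproj (s t : C) : 'M[C]_n := (1%:M + s *: F) *m (1%:M + t *: G).

Lemma eigenprojE s t : eigenproj s t =
  1%:M + s *: F + t *: G + (s * t) *: fun_mx (f \o g).
Proof.
rewrite /eigenproj mulmxDl !mulmxDr !mul1mx mulmx1 -scalemxAl -scalemxAr.
by rewrite scalerA mul_fun_mx addrA [_ + _ *: G + _]addrAC.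
Qed.

Lemma mxtrace_mul_eigenproj (X : 'M[C]_n) s t : \tr (X *m eigenproj s t) =
  \tr X + s * \tr (X *m F) + t * \tr (X *m G) +
  s * t * \tr (X *m fun_mx (f \o g)).
Proof.
by rewrite eigenprojE !mulmxDr mulmx1 -!scalemxAr !mxtraceD !mxtraceZ.
Qed.

Hypotheses (fK : involutive f) (gK : involutive g).
Hypothesis fg : forall x, f (g x) = g (f x).

(** Four times a Hermitian projection, multiplied by its adjoint, is four times itself; positivity
    can be read off this form. *)
Lemma eigenproj_mul_adj s t : s ^+ 2 = 1 -> t ^+ 2 = 1 ->
  eigenproj s t = 4^-1 *: (eigenproj s t *m (eigenproj s t)^t*).
Proof.
move=> s1 t1.
have real (u : C) : u ^+ 2 = 1 -> Num.conj u = u.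
  by move=> /eqP; rewrite sqrf_eq1 => /orP[] /eqP ->; rewrite ?rmorphN rmorph1.
have sq (u : C) (E : 'M[C]_n) : u ^+ 2 = 1 -> E *m E = 1%:M ->
    (1%:M + u *: E) *m (1%:M + u *: E) = 2 *: (1%:M + u *: E).
  move=> u1 EE; rewrite mulmxDl !mulmxDr !mul1mx mulmx1 -scalemxAl -scalemxAr EE.
  by rewrite scalerA -expr2 u1 scale1r (addrC _ 1%:M) -mulr2n scaler_nat.
have comm : (1%:M + t *: G) *m (1%:M + s *: F) = eigenproj s t.
  rewrite eigenprojE mulmxDl !mulmxDr !mul1mx mulmx1 -scalemxAl -scalemxAr.
  rewrite scalerA mul_fun_mx addrA mulrC; congr (_ + _ *: _).
  by apply/matrixP => x y; rewrite !mxE /= fg.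
have adj (u : C) (E : 'M[C]_n) : u ^+ 2 = 1 -> E^t* = E ->
    (1%:M + u *: E)^t* = 1%:M + u *: E.
  move=> u1 EE; rewrite -[in RHS]EE; apply/matrixP => x y.
  by rewrite !mxE rmorphD rmorphM rmorph_nat /= real // eq_sym.
have -> : (eigenproj s t)^t* = eigenproj s t.
  by rewrite trmx_mul map_mxM /= !adj ?comm //; exact: adj_fun_mx.
rewrite {2}/eigenproj -comm -mulmxA (mulmxA (1%:M + _ *: G)).
rewrite (sq t) ?fun_mx_invol // -scalemxAl comm -scalemxAr /eigenproj mulmxA.
rewrite (sq s) ?fun_mx_invol // -scalemxAl !scalerA.
have -> : 4^-1 * (2 * 2) = 1 :> C by field.
by rewrite scale1r.
Qed.

(* When f and g swap A with A' and B with B', and d = dB, this is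
   2 (dB + 1) tr (Y X) for the dual solution
   Y = P+ (x) P- + (dB - 1)/(dB + 1) P- (x) P+, where P+ and P- are the
   projections onto the symmetric and antisymmetric subspaces. *)
Definition witness (d : nat) (X : 'M[C]_n) : C :=
  d%:R * (\tr X - \tr (X *m fun_mx (f \o g))) + \tr (X *m F) - \tr (X *m G).

Lemma witnessB d a b (X Y : 'M[C]_n) :
  witness d (a *: X - b *: Y) = a * witness d X - b * witness d Y.
Proof.
rewrite /witness !(mulmxBl, =^~ scalemxAl) !(mxtraceD, raddfN) /= !mxtraceZ.
by ring.
Qed.

End CommutingInvolutions.

(** * Bounds on the dual functional *)

Section WitnessBounds.
Variable R : realType.
Local Notation C := R[i].
Local Open Scope sesquilinear_scope.

Lemma psdmx_mul_adj n (A : 'M[C]_n) : psdmx (A *m A^t*).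
Proof.
have := psdmx_sum_outer (fun r x => A x r); congr psdmx.
apply/matrixP => x y; rewrite !mxE; apply: eq_bigr => r _.
by rewrite !mxE.
Qed.

Variables (n : nat) (f g : 'I_n -> 'I_n).
Hypotheses (fK : involutive f) (gK : involutive g).
Hypothesis fg : forall x, f (g x) = g (f x).

Lemma psdmx_eigenproj (s t : C) :
  s ^+ 2 = 1 -> t ^+ 2 = 1 -> psdmx (eigenproj f g s t).
Proof.
move=> s1 t1; rewrite (eigenproj_mul_adj fK gK fg s1 t1).
by apply: psdmxZ; [rewrite invr_ge0|exact: psdmx_mul_adj].
Qed.

(** Up to the factor 2 (d + 1) this is 0 <= Y <= 1: on the eigenspaces with signs (1, 1), (1, -1),
    (-1, 1) and (-1, -1), Y takes the values 0, 1, (d - 1)/(d + 1) and 0. *)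
Lemma witness_bounds d (X : 'M[C]_n) : (0 < d)%N -> psdmx X ->
  0 <= witness f g d X <= 2 * (d%:R + 1) * \tr X.
Proof.
move=> d0 X0.
have q s t : s ^+ 2 = 1 -> t ^+ 2 = 1 ->
    0 <= \tr X + s * \tr (X *m fun_mx C f) + t * \tr (X *m fun_mx C g) +
         s * t * \tr (X *m fun_mx C (f \o g)).
  move=> s1 t1; rewrite -mxtrace_mul_eigenproj.
  exact: psdmx_trM_ge0 X0 (psdmx_eigenproj s1 t1).
have p1 : 1 ^+ 2 = 1 :> C by rewrite expr1n.
have m1 : (-1) ^+ 2 = 1 :> C by rewrite sqrrN.
have d1 : 0 <= d%:R - 1 :> C by rewrite subr_ge0 ler1n.
have dp : 0 <= d%:R + 1 :> C by rewrite addr_ge0 ?ler0n.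
have := q _ _ m1 m1; have := q _ _ m1 p1; have := q _ _ p1 m1; have := q _ _ p1 p1.
rewrite /witness.
move: (\tr (X *m fun_mx C f)) (\tr (X *m fun_mx C g)).
move: (\tr (X *m fun_mx C (f \o g))) (\tr X) (d%:R : C) d1 dp.
move=> c x e e1 ep a b qpp qpm qmp qmm; apply/andP; split.
  have -> : e * (x - c) + a - b = 2^-1 *
     ((e + 1) * (x + 1 * a + -1 * b + 1 * -1 * c) +
      (e - 1) * (x + -1 * a + 1 * b + -1 * 1 * c)) by field.
  by rewrite mulr_ge0 ?invr_ge0 // addr_ge0 // mulr_ge0.
rewrite -subr_ge0.
have -> : 2 * (e + 1) * x - (e * (x - c) + a - b) = 2^-1 *
   ((e + 1) * ((x + 1 * a + 1 * b + 1 * 1 * c) +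
               (x + -1 * a + -1 * b + -1 * -1 * c)) +
    2 * (x + -1 * a + 1 * b + -1 * 1 * c)) by field.
by rewrite mulr_ge0 ?invr_ge0 // addr_ge0 // mulr_ge0 // addr_ge0.
Qed.

End WitnessBounds.

(** * The swaps, and the entries of a supermap that conjugates channels *)

Section Swaps.
Variable R : realType.
Local Notation C := R[i].
Variables dA dB : nat.
Local Notation superop := (superop R dA dB).
Local Notation idx := 'I_(dA * dA * dB * dB).
Local Open Scope sesquilinear_scope.

Definition flipA (x : idx) : idx :=
  let: (x3, b') := mxtens_unindex x in
  let: (x2, b) := mxtens_unindex x3 in
  let: (a', a) := mxtens_unindex x2 in ix4 a a' b b'.

Definition flipB (x : idx) : idx :=
  let: (x3, b') := mxtens_unindex x in
  let: (x2, b) := mxtens_unindex x3 in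
  let: (a', a) := mxtens_unindex x2 in ix4 a' a b' b.

Variant is_ix4 : idx -> Type := IsIx4 a' a b b' : is_ix4 (ix4 a' a b b').

Lemma ix4P x : is_ix4 x.
Proof.
case: (mxtens_indexP x) => x3 b'; case: (mxtens_indexP x3) => x2 b.
by case: (mxtens_indexP x2) => a' a; exact: IsIx4.
Qed.

Lemma eq_ix4 (a' a c' c : 'I_dA) (b b' d d' : 'I_dB) :
  (ix4 a' a b b' == ix4 c' c d d') = [&& a' == c', a == c, b == d & b' == d'].
Proof.
have eq_ix m n (u v : 'I_m * 'I_n) : (mxtens_index u == mxtens_index v) = (u == v).
  exact: (can_eq (@mxtens_indexK m n)).
by rewrite /ix4 !(eq_ix, xpair_eqE) -!andbA.
Qed.

Lemma flipAE a' a b b' : flipA (ix4 a' a b b') = ix4 a a' b b'.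
Proof. by rewrite /flipA !mxtens_indexK. Qed.

Lemma flipBE a' a b b' : flipB (ix4 a' a b b') = ix4 a' a b' b.
Proof. by rewrite /flipB !mxtens_indexK. Qed.

Lemma flipAK : involutive flipA.
Proof. by move=> x; case: (ix4P x) => *; rewrite !flipAE. Qed.

Lemma flipBK : involutive flipB.
Proof. by move=> x; case: (ix4P x) => *; rewrite !flipBE. Qed.

Lemma flipAB x : flipA (flipB x) = flipB (flipA x).
Proof. by case: (ix4P x) => *; rewrite !(flipAE, flipBE). Qed.

Local Notation swapA := (fun_mx C flipA).
Local Notation swapB := (fun_mx C flipB).
Local Notation swapAB := (fun_mx C (flipA \o flipB)).

Lemma mxtrace_mul_swapA (X : superop) : \tr (X *m swapA) =
  \sum_a' \sum_a \sum_b \sum_b' X (ix4 a' a b b') (ix4 a a' b b').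
Proof.
rewrite mxtrace_mul_fun_mx sum_ix4; do 4! (apply: eq_bigr => ? _).
by rewrite flipAE.
Qed.

Lemma mxtrace_mul_swapB (X : superop) : \tr (X *m swapB) =
  \sum_a' \sum_a \sum_b \sum_b' X (ix4 a' a b b') (ix4 a' a b' b).
Proof.
rewrite mxtrace_mul_fun_mx sum_ix4; do 4! (apply: eq_bigr => ? _).
by rewrite flipBE.
Qed.

Lemma mxtrace_mul_swapAB (X : superop) : \tr (X *m swapAB) =
  \sum_a' \sum_a \sum_b \sum_b' X (ix4 a' a b b') (ix4 a a' b' b).
Proof.
rewrite mxtrace_mul_fun_mx sum_ix4; do 4! (apply: eq_bigr => ? _).
by rewrite /= flipBE flipAE.
Qed.

(** The 0/1 terms are the entries of F_A F_B. For fixed indices on A' and B', X - F_A F_B is a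
    matrix on AB orthogonal to every channel, and [orth_choi_channels] gives its form. *)
Lemma conjugates_channels_entry (X : superop) a' a b b' c' c d d' :
  (0 < dB)%N -> conjugates_channels X ->
  X (ix4 a' a b b') (ix4 c' c d d') -
    ((mxtens_index (a, b) == mxtens_index (c', d')) &&
     (mxtens_index (c, d) == mxtens_index (a', b')))%:R =
  (b == d)%:R * (dB%:R^-1 * \sum_k (X (ix4 a' a k b') (ix4 c' c k d') -
    ((mxtens_index (a, k) == mxtens_index (c', d')) &&
     (mxtens_index (c, k) == mxtens_index (a', b')))%:R)).
Proof.
move=> dB0 cX.
(* The indices u and v are exchanged because tr (H J) pairs H v u with J u v. *)
pose H : 'M[C]_(dA * dB) := \matrix_(v, u)
  (X (ix4 a' (mxtens_unindex u).1 (mxtens_unindex u).2 b')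
     (ix4 c' (mxtens_unindex v).1 (mxtens_unindex v).2 d') -
   ((u == mxtens_index (c', d')) && (v == mxtens_index (a', b')))%:R).
have HJ (J : 'M[C]_(dA * dB)) :
    psdmx J -> ptracer J = 1%:M -> \tr (H *m J) = 0.
  move=> J0 J1.
  have /matrixP/(_ (mxtens_index (a', b')) (mxtens_index (c', d'))) :=
    conjugates_channels_choi cX J0 J1.
  rewrite ptrace_ABE => e; rewrite -[RHS](subrr (J^T (mxtens_index (a', b')) (mxtens_index (c', d')))).
  rewrite -[in X in X - _]e [in RHS]mxE mxtrace_mulC /mxtrace.
  under eq_bigr do rewrite mxE.
  have -> : J (mxtens_index (c', d')) (mxtens_index (a', b')) =
     \sum_u \sum_v J u v *
       ((u == mxtens_index (c', d')) && (v == mxtens_index (a', b')))%:R.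
    rewrite (bigD1 (mxtens_index (c', d'))) //= [X in _ = _ + X]big1; last first.
      by move=> u /negbTE uc; apply: big1 => v _; rewrite uc mulr0.
    rewrite (bigD1 (mxtens_index (a', b'))) //= big1; last first.
      by move=> v /negbTE va; rewrite va andbF mulr0.
    by rewrite !eqxx mulr1 !addr0.
  rewrite [X in _ = X - _](_ : _ = \sum_u \sum_v J u v *
     X (ix4 a' (mxtens_unindex u).1 (mxtens_unindex u).2 b')
     (ix4 c' (mxtens_unindex v).1 (mxtens_unindex v).2 d')).
    rewrite -sumrB; apply: eq_bigr => u _; rewrite -sumrB; apply: eq_bigr => v _.
    by rewrite mxE mulrBr.
  rewrite sum_mxtens; apply: eq_bigr => p _; apply: eq_bigr => q _.
  rewrite sum_mxtens; apply: eq_bigr => r _; apply: eq_bigr => t _.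
  by rewrite !mxtens_indexK mulrC.
have /matrixP/(_ (mxtens_index (c, d)) (mxtens_index (a, b))) :=
  orth_choi_channels dB0 HJ.
rewrite tensmxE !mxE !mxtens_indexK /= => ->; rewrite mulrC -mulrA mulrCA eq_sym.
by congr (_ * (_ * _)); apply: eq_bigr => k _; rewrite mxE !mxtens_indexK.
Qed.

End Swaps.

(** * The lower bound by duality *)

Section LowerBound.
Variable R : realType.
Local Notation C := R[i].
Variables dA dB : nat.
Local Notation superop := (superop R dA dB).
Local Notation swapA := (fun_mx C (@flipA dA dB)).
Local Notation swapB := (fun_mx C (@flipB dA dB)).
Local Notation swapAB := (fun_mx C (@flipA dA dB \o @flipB dA dB)).
Local Notation witness := (@witness C _ (@flipA dA dB) (@flipB dA dB) dB).

Lemma sumr_delta (I : finType) (i : I) (V : pzRingType) (f : I -> V) :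
  \sum_j (i == j)%:R * f j = f i.
Proof.
rewrite (bigD1 i) //= eqxx mul1r big1 ?addr0 // => j ji.
by rewrite eq_sym (negbTE ji) mul0r.
Qed.

Lemma sum_const (n : nat) (c : C) : \sum_(i < n) c = n%:R * c.
Proof. by rewrite sumr_const card_ord mulr_natl. Qed.

(** The entry formula fixes tr (X F_B), and fixes tr (X F_A F_B) up to the unknown tr (X F_A) / dB.
    With the weights [dB] and 1 in [witness], the unknown cancels. *)
Lemma witness_conj (X : superop) : (0 < dB)%N -> conjugates_channels X ->
  \tr X = (dA * dB)%:R ->
  witness X = - (dA%:R ^+ 2 * dB%:R * (dB%:R ^+ 2 - 1)).
Proof.
move=> dB0 cX trX.
have dBn : dB%:R != 0 :> C by rewrite pnatr_eq0 -lt0n.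
have eq_ix m n (u v : 'I_m * 'I_n) : (mxtens_index u == mxtens_index v) = (u == v).
  exact: (can_eq (@mxtens_indexK m n)).
have eAB : \tr (X *m swapAB) = dA%:R ^+ 2 * (dB%:R ^+ 2 - 1) +
    dB%:R^-1 * \tr (X *m swapA).
  have inner (a' a : 'I_dA) : \sum_b \sum_b' X (ix4 a' a b b') (ix4 a a' b' b) =
     dB%:R ^+ 2 - 1 + dB%:R^-1 * \sum_b \sum_b' X (ix4 a' a b b') (ix4 a a' b b').
    (* At the entries picked by tr (X F_A F_B), F_A F_B itself is 1; at those picked by tr (X F_B),
       treated next, it is the indicator of a' = a. *)
    have e (b b' : 'I_dB) : X (ix4 a' a b b') (ix4 a a' b' b) = 1 + (b == b')%:R *
       (dB%:R^-1 * (\sum_k X (ix4 a' a k b') (ix4 a a' k b) - 1)).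
      have := conjugates_channels_entry a' a b b' a a' b' b dB0 cX.
      rewrite !eqxx /= => /eqP; rewrite subr_eq => /eqP ->; rewrite addrC.
      congr (_ + _); have [->|_] := eqVneq b b'; last by rewrite !mul0r.
      congr (_ * (_ * _)); rewrite sumrB; congr (_ - _).
      under eq_bigr do rewrite !eq_ix !xpair_eqE !eqxx /= andbb eq_sym -[_%:R]mulr1.
      exact: sumr_delta.
    under eq_bigr do under eq_bigr do rewrite e.
    under eq_bigr do rewrite big_split sumr_delta /= sum_const mulr1.
    rewrite big_split /= sum_const -mulr_sumr sumrB sum_const mulr1.
    by rewrite [X in _ * (X - _)]exchange_big /=; move: (\sum_i _) => S; field.
  rewrite mxtrace_mul_swapAB mxtrace_mul_swapA.
  under eq_bigr do under eq_bigr do rewrite inner.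
  under eq_bigr do rewrite big_split /= sum_const -mulr_sumr.
  by rewrite big_split /= sum_const -mulr_sumr expr2 mulrA.
have eB : \tr (X *m swapB) = dA%:R * (dB%:R ^+ 2 - 1) + dB%:R^-1 * \tr X.
  have inner (a' a : 'I_dA) : \sum_b \sum_b' X (ix4 a' a b b') (ix4 a' a b' b) =
     (a' == a)%:R * (dB%:R ^+ 2 - 1) +
     dB%:R^-1 * \sum_b \sum_b' X (ix4 a' a b b') (ix4 a' a b b').
    have e (b b' : 'I_dB) : X (ix4 a' a b b') (ix4 a' a b' b) =
       (a' == a)%:R + (b == b')%:R *
       (dB%:R^-1 * (\sum_k X (ix4 a' a k b') (ix4 a' a k b) - (a' == a)%:R)).
      have := conjugates_channels_entry a' a b b' a' a b' b dB0 cX.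
      rewrite !eq_ix !xpair_eqE !eqxx /= !andbT (eq_sym a) andbb => /eqP.
      rewrite subr_eq => /eqP ->; rewrite addrC.
      congr (_ + _); have [->|_] := eqVneq b b'; last by rewrite !mul0r.
      congr (_ * (_ * _)); rewrite sumrB; congr (_ - _).
      under eq_bigr => k _.
        rewrite !eq_ix !xpair_eqE (eq_sym a) (eq_sym k) andbb -mulnb natrM mulrC.
        over.
      exact: sumr_delta.
    under eq_bigr do under eq_bigr do rewrite e.
    under eq_bigr do rewrite big_split sumr_delta /= sum_const.
    rewrite big_split /= sum_const -mulr_sumr sumrB sum_const.
    by rewrite [X in _ * (X - _)]exchange_big /=; move: (\sum_i _) => S; field.
  rewrite mxtrace_mul_swapB [\tr X]sum_ix4.
  under eq_bigr do under eq_bigr do rewrite inner.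
  under eq_bigr do rewrite big_split /= sumr_delta -mulr_sumr.
  by rewrite big_split /= sum_const -mulr_sumr.
rewrite /witness eAB eB; move: trX => ->; rewrite natrM.
by move: (\tr _) => tA; field.
Qed.

Lemma virtual_comb_tr (X : superop) : virtual_comb X -> \tr X = (dA * dB)%:R.
Proof.
case=> n [a [Z [a1 Z0 ->]]]; rewrite raddf_sum /=.
rewrite (eq_bigr (fun i => (a i)%:C%C * (dA * dB)%:R)); last first.
  by move=> i _; rewrite mxtraceZ comb_tr.
by rewrite -mulr_suml -rmorph_sum a1 mul1r.
Qed.

(** [witness] is nonnegative on [Xp] and at most 2 (dB + 1) dA dB on [Xm], while its value on X is
    the fixed nonpositive number of [witness_conj]; this forces 2 [am] >= dA (dB - 1). *)
Lemma base_norm_lower (X : superop) : (0 < dA)%N -> (0 < dB)%N ->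
  virtual_comb X -> conjugates_channels X ->
  (dA * dB)%:R - dA%:R + 1 <= base_norm X.
Proof.
move=> dA0 dB0 vX cX; have trX := virtual_comb_tr vX.
apply: lb_le_inf; first exact: virtual_comb_decomp.
move=> _ [ap [am [Xp [Xm [[ap0 am0 cp cm eX] ->]]]]].
have [dAn dBn] : 0 < dA%:R :> R /\ 0 < dB%:R :> R by rewrite !ltr0n.
have rC (n : nat) : n%:R = (n%:R : R)%:C%C by rewrite rmorph_nat.
have eapm : ap = 1 + am.
  have := trX; rewrite eX mxtraceD raddfN /= !mxtraceZ !comb_tr // -mulrBl.
  rewrite !rC -rmorphB -rmorphM => /(congr1 (@complex.Re R)) /= e.
  apply/eqP; rewrite -subr_eq; apply/eqP.
  apply: (mulIf (x := (dA * dB)%:R)); last by rewrite e mul1r.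
  by rewrite pnatr_eq0 muln_eq0 !gtn_eqF.
have [Xp0 _ _] := cp; have [Xm0 _ _] := cm.
have /andP[wp _] := witness_bounds (@flipAK _ _) (@flipBK _ _) (@flipAB _ _) dB0 Xp0.
have /andP[_] := witness_bounds (@flipAK _ _) (@flipBK _ _) (@flipAB _ _) dB0 Xm0; rewrite comb_tr // => wm.
have := witness_conj dB0 cX trX.
have -> : witness X = ap%:C%C * witness Xp - am%:C%C * witness Xm.
  by rewrite eX witnessB.
have apC : 0 <= ap%:C%C :> C by rewrite lecR.
have amC : 0 <= am%:C%C :> C by rewrite lecR.
have h1 := mulr_ge0 apC wp.
have h2 := ler_wpM2l amC wm.
move=> e.
have {h1 h2 e} : dA%:R ^+ 2 * dB%:R * (dB%:R ^+ 2 - 1) <=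
    am%:C%C * (2 * (dB%:R + 1) * (dA * dB)%:R) :> C.
  apply: le_trans h2; rewrite -(opprK (_ * (_ - 1))) -e opprB lerBlDr.
  by rewrite lerDl.
have oneC : 1 = (1 : R)%:C%C by [].
rewrite natrM !rC oneC -!(rmorphXn, rmorphB, rmorphD, rmorphM) /= lecR => h.
have : (dA%:R * dB%:R * (dB%:R + 1)) * (dA%:R * (dB%:R - 1)) <=
   (dA%:R * dB%:R * (dB%:R + 1)) * (2 * am) :> R.
  by move: h; lra.
rewrite ler_pM2l; last by rewrite !mulr_gt0 // addr_gt0.
by rewrite eapm natrM; lra.
Qed.

End LowerBound.

(** * The span of two commuting involutions and their product *)

Section InvolutionSpan.
Variables (C : numClosedFieldType) (n : nat) (f g : 'I_n -> 'I_n).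

Definition inv_span (c0 c1 c2 c3 : C) : 'M[C]_n :=
  c0 *: 1%:M + c1 *: fun_mx C f + c2 *: fun_mx C g + c3 *: fun_mx C (f \o g).

Lemma inv_spanD c0 c1 c2 c3 d0 d1 d2 d3 :
  inv_span c0 c1 c2 c3 + inv_span d0 d1 d2 d3 =
  inv_span (c0 + d0) (c1 + d1) (c2 + d2) (c3 + d3).
Proof. by apply/matrixP => x y; rewrite !mxE; ring. Qed.

Lemma inv_spanZ a c0 c1 c2 c3 :
  a *: inv_span c0 c1 c2 c3 = inv_span (a * c0) (a * c1) (a * c2) (a * c3).
Proof. by apply/matrixP => x y; rewrite !mxE; ring. Qed.

Lemma eigenproj_span s t : eigenproj f g s t = inv_span 1 s t (s * t).
Proof. by rewrite eigenprojE /inv_span scale1r. Qed.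

(** The eigenvalues are 4x for the signs (1, 1), 4y for (-1, -1), and 0 for opposite signs. *)
Lemma inv_span_same x y : inv_span (x + y) (x - y) (x - y) (x + y) =
  x *: eigenproj f g 1 1 + y *: eigenproj f g (-1) (-1).
Proof. by rewrite !eigenproj_span !inv_spanZ inv_spanD; congr inv_span; ring. Qed.

Lemma inv_span_opp z :
  inv_span z z (- z) (- z) = z *: eigenproj f g 1 (-1).
Proof. by rewrite eigenproj_span inv_spanZ; congr inv_span; ring. Qed.

Lemma inv_span_opp_id z : g =1 id -> inv_span z z (- z) (- z) = 0.
Proof. by move=> g1; apply/matrixP => x y; rewrite !mxE /= !g1; ring. Qed.

Lemma inv_spanB c0 c1 c2 c3 d0 d1 d2 d3 :
  inv_span c0 c1 c2 c3 - inv_span d0 d1 d2 d3 =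
  inv_span (c0 - d0) (c1 - d1) (c2 - d2) (c3 - d3).
Proof. by apply/matrixP => x y; rewrite !mxE; ring. Qed.

End InvolutionSpan.

(** * Combs and conjugating supermaps in the span of the swaps *)

Section SwapSpan.
Variable R : realType.
Local Notation C := R[i].
Variables dA dB : nat.
Local Notation superop := (superop R dA dB).
Local Notation swap_span := (@inv_span C _ (@flipA dA dB) (@flipB dA dB)).

Lemma swap_spanE c0 c1 c2 c3 a' a b b' c' c d d' :
  swap_span c0 c1 c2 c3 (ix4 a' a b b') (ix4 c' c d d') =
  (a' == c')%:R * (a == c)%:R *
    (c0 * ((b == d)%:R * (b' == d')%:R) + c2 * ((b == d')%:R * (b' == d)%:R)) +
  (a' == c)%:R * (a == c')%:R *
    (c1 * ((b == d)%:R * (b' == d')%:R) + c3 * ((b == d')%:R * (b' == d)%:R)).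
Proof.
rewrite !mxE /= !flipBE !flipAE !eq_ix4 -!mulnb !natrM.
by ring.
Qed.

Lemma sumr_delta_mul (m : nat) (i j : 'I_m) :
  \sum_k (i == k)%:R * (k == j)%:R = (i == j)%:R :> C.
Proof. by rewrite (sumr_delta i (fun k => (k == j)%:R)). Qed.

(** Tracing out B' turns both 1 and F_B into multiples of 1_B, with factors dB and 1, so the
    condition on B is automatic. Tracing out A then turns 1 and F_A into dA and 1 times the
    identity, which leaves one scalar normalization. *)
Lemma comb_swap_span c0 c1 c2 c3 : (0 < dB)%N ->
  psdmx (swap_span c0 c1 c2 c3) ->
  dA%:R * (dB%:R * c0 + c2) + dB%:R * c1 + c3 = 1 ->
  comb (swap_span c0 c1 c2 c3 : superop).
Proof.
move=> dB0 S0 e1; have dBn : dB%:R != 0 :> C by rewrite pnatr_eq0 -lt0n.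
pose W : 'M[C]_(dA * dA) := \matrix_(x, y)
  let: (a', a) := mxtens_unindex x in let: (c', c) := mxtens_unindex y in
  (dB%:R * c0 + c2) * ((a' == c')%:R * (a == c)%:R) +
  (dB%:R * c1 + c3) * ((a' == c)%:R * (a == c')%:R).
have WE a' a c' c : W (mxtens_index (a', a)) (mxtens_index (c', c)) =
    (dB%:R * c0 + c2) * ((a' == c')%:R * (a == c)%:R) +
    (dB%:R * c1 + c3) * ((a' == c)%:R * (a == c')%:R).
  by rewrite mxE !mxtens_indexK.
have eS : ptracer (swap_span c0 c1 c2 c3 : superop) = W *t 1%:M.
  apply/matrixP => x y.
  case: (mxtens_indexP x) => x2 b; case: (mxtens_indexP x2) => a' a.
  case: (mxtens_indexP y) => y2 d; case: (mxtens_indexP y2) => c' c.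
  rewrite mxE tensmxE WE !mxE.
  under eq_bigr => k _ do rewrite (swap_spanE c0 c1 c2 c3 a' a b k c' c d k) eqxx mulr1.
  rewrite big_split /= -!mulr_sumr !big_split /= -!mulr_sumr sumr_delta_mul.
  rewrite !sum_const; ring.
split=> //.
  rewrite eS ptracer_tens mxtrace1; apply/matrixP => x y; rewrite !mxE.
  by case: (_ == _); rewrite ?mulr0 // !mulr1 mulrAC mulfV ?mul1r.
rewrite eS; apply/matrixP => x y.
case: (mxtens_indexP x) => a' b; case: (mxtens_indexP y) => c' d.
rewrite mxE !mxtens_indexK /=.
under eq_bigr => k _ do rewrite tensmxE WE eqxx.
rewrite -mulr_suml big_split /= -!mulr_sumr sumr_delta_mul sum_const !mxE.
rewrite (can_eq (@mxtens_indexK _ _)) xpair_eqE -mulnb natrM.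
by rewrite -[RHS]mul1r -[X in _ = X * _]e1; ring.
Qed.

(** F_A F_B returns J^T. As Tr_B J = 1_A, the other two terms return c0 dA and c1 times the
    identity, and these cancel. *)
Lemma conjugates_channels_swap_span c0 c1 : c0 * dA%:R + c1 = 0 ->
  conjugates_channels (swap_span c0 c1 0 1 : superop).
Proof.
move=> e0; apply: conjugates_channelsP => J J1.
apply/matrixP => x y.
case: (mxtens_indexP x) => a' b'; case: (mxtens_indexP y) => c' d'.
rewrite ptrace_ABE [RHS]mxE.
have J1E i j : \sum_b J (mxtens_index (i, b)) (mxtens_index (j, b)) = (i == j)%:R.
  by have /matrixP/(_ i j) := J1; rewrite !mxE.
have e a b : \sum_c \sum_d swap_span c0 c1 0 1 (ix4 a' a b b') (ix4 c' c d d') *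
      J (mxtens_index (a, b)) (mxtens_index (c, d)) =
   (a' == c')%:R * (b' == d')%:R * c0 * J (mxtens_index (a, b)) (mxtens_index (a, b)) +
   (c' == a)%:R * ((b' == d')%:R * c1 * J (mxtens_index (a, b)) (mxtens_index (a', b)) +
   (d' == b)%:R * J (mxtens_index (a, b)) (mxtens_index (a', b'))).
  (* Each term is expanded back into a sum over c and d against deltas, so that the two sides agree
     term by term. *)
  rewrite -(sumr_delta a (fun c => (a' == c')%:R * (b' == d')%:R * c0 *
      J (mxtens_index (a, b)) (mxtens_index (c, b)))).
  rewrite -(sumr_delta a' (fun c => (b' == d')%:R * c1 * J (mxtens_index (a, b))
      (mxtens_index (c, b)) + (d' == b)%:R * J (mxtens_index (a, b)) (mxtens_index (c, b')))).
  rewrite mulr_sumr -big_split; apply: eq_bigr => c _ /=.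
  rewrite -(sumr_delta b (fun d => (a' == c')%:R * (b' == d')%:R * c0 *
      J (mxtens_index (a, b)) (mxtens_index (c, d)))).
  rewrite -(sumr_delta b (fun d => (b' == d')%:R * c1 * J (mxtens_index (a, b))
      (mxtens_index (c, d)))).
  rewrite -(sumr_delta b' (fun d => (d' == b)%:R * J (mxtens_index (a, b))
      (mxtens_index (c, d)))).
  rewrite -big_split !mulr_sumr -big_split; apply: eq_bigr => d _ /=.
  rewrite swap_spanE (eq_sym b d') (eq_sym a c'); ring.
under eq_bigr do under eq_bigr do rewrite e.
under eq_bigr do rewrite big_split /= -!mulr_sumr J1E eqxx big_split /= -mulr_sumr J1E sumr_delta.
rewrite big_split /= sumr_delta sum_const mulr1 (eq_sym a').
rewrite -[RHS]addr0 -(mulr0 ((c' == a')%:R * (b' == d')%:R)) -e0.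
ring.
Qed.

End SwapSpan.

(** * Positivity in the span of involutions *)

Section PsdInvolutionSpan.
Variable R : realType.
Local Notation C := R[i].
Variables (n : nat) (f g : 'I_n -> 'I_n).
Hypotheses (fK : involutive f) (gK : involutive g).
Hypothesis fg : forall x, f (g x) = g (f x).

Lemma psdmx_span_same (x y : C) : 0 <= x -> 0 <= y ->
  psdmx (inv_span f g (x + y) (x - y) (x - y) (x + y)).
Proof.
move=> x0 y0.
rewrite inv_span_same.
apply: psdmxD; apply: psdmxZ => //; apply: psdmx_eigenproj => //.
- by rewrite expr1n.
- by rewrite expr1n.
- by rewrite sqrrN expr1n.
- by rewrite sqrrN expr1n.
Qed.

Lemma psdmx_span_opp (z : C) : 0 <= z -> psdmx (inv_span f g z z (- z) (- z)).
Proof.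
move=> z0; rewrite inv_span_opp.
apply: psdmxZ => //; apply: psdmx_eigenproj => //; first by rewrite expr1n.
by rewrite sqrrN expr1n.
Qed.

End PsdInvolutionSpan.

(** * The optimal decomposition *)

Section OptimalComb.
Variable R : realType.
Local Notation C := R[i].
Variables dA dB : nat.
Local Notation superop := (superop R dA dB).
Local Notation fA := (@flipA dA dB).
Local Notation fB := (@flipB dA dB).
Local Notation swap_span := (@inv_span C _ fA fB).

Lemma flipB_triv : (dB <= 1)%N -> fB =1 id.
Proof.
move=> dB1 x; case: (ix4P x) => a' a b b'; rewrite flipBE.
suff -> : b = b' by [].
by apply: val_inj; case: b b' => [b hb] [b' hb'] /=; lia.
Qed.

Lemma comb_of_psd (c0 c1 c2 c3 : C) (t : R) : (0 < dB)%N -> 0 < t ->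
  psdmx (swap_span c0 c1 c2 c3) ->
  dA%:R * (dB%:R * c0 + c2) + dB%:R * c1 + c3 = t%:C%C ->
  exists2 Z : superop, comb Z & t%:C%C *: Z = swap_span c0 c1 c2 c3.
Proof.
move=> dB0 t0 S0 e; have tn : t%:C%C != 0 by rewrite gt_eqF // ltcR.
exists (t%:C%C^-1 *: swap_span c0 c1 c2 c3); last by rewrite scalerA divff // scale1r.
rewrite inv_spanZ; apply: (comb_swap_span dB0).
  by rewrite -inv_spanZ; apply: psdmxZ; [rewrite invr_ge0 lecR ltW|exact: S0].
by rewrite -[RHS](mulVf tn) -e; ring.
Qed.

(* The positive part is 2/(dA + 1) P+ (x) P+ + 2 P- (x) P- and the negative part
   is 2 dA/(dA + 1) P+ (x) P-; the latter vanishes for dB = 1, and then any comb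
   serves as Zm. *)
Lemma optimal_decomp : (0 < dA)%N -> (0 < dB)%N ->
  exists Zp Zm : superop,
    comb_decomp (swap_span (dA%:R + 1)^-1 (- dA%:R / (dA%:R + 1)) 0 1)
      ((dA%:R * dB%:R - dA%:R + 2) / 2) (dA%:R * (dB%:R - 1) / 2) Zp Zm.
Proof.
move=> dA0 dB0.
have dA1 : dA%:R + 1 != 0 :> C by rewrite natr1 pnatr_eq0.
have dBR : 1 <= dB%:R :> R by rewrite ler1n.
have dAR : 0 < dA%:R :> R by rewrite ltr0n.
(* The two weights are the traces of the parts divided by dA dB. The negative one is 2 dA/(dA + 1)
   times the dimension dA (dA + 1)/2 * dB (dB - 1)/2, over dA dB. *)
have am0 : 0 <= dA%:R * (dB%:R - 1) / 2 :> R.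
  by rewrite divr_ge0 // mulr_ge0 ?subr_ge0 // ltW.
have ap0 : 0 < (dA%:R * dB%:R - dA%:R + 2) / 2 :> R.
  by rewrite (_ : _ / 2 = dA%:R * (dB%:R - 1) / 2 + 1); [rewrite ltr_wpDl|field].
have oneC : (1 : R)%:C%C = 1 by [].
(* [x], [y] and, for the negative part, dA [x] are quarters of the eigenvalues, since [eigenproj] is
   four times a projection. *)
pose x : C := (2 * (dA%:R + 1))^-1; pose y : C := 2^-1.
have x0 : 0 <= x by rewrite invr_ge0 mulr_ge0 // addr_ge0.
have y0 : 0 <= y by rewrite invr_ge0.
have [Zp cp eZp] : exists2 Zp : superop, comb Zp &
    ((dA%:R * dB%:R - dA%:R + 2) / 2 : R)%:C%C *: Zp =
    swap_span (x + y) (x - y) (x - y) (x + y).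
  apply: (comb_of_psd dB0 ap0).
    exact: (psdmx_span_same (@flipAK _ _) (@flipBK _ _) (@flipAB _ _) x0 y0).
  rewrite !(rmorphM, rmorphD, rmorphB, fmorphV) /= !rmorph_nat /x /y.
  by field.
have [Zm cm eZm] : exists2 Zm : superop, comb Zm &
    (dA%:R * (dB%:R - 1) / 2 : R)%:C%C *: Zm =
    swap_span (dA%:R * x) (dA%:R * x) (- (dA%:R * x)) (- (dA%:R * x)).
  have [dB1|dB1] := leqP dB 1.
    exists Zp; first exact: cp.
    have -> : dB%:R = 1 :> R by rewrite (_ : dB = 1%N) //; lia.
    rewrite subrr mulr0 mul0r scale0r inv_span_opp_id //.
    exact: flipB_triv.
  have am_gt0 : 0 < dA%:R * (dB%:R - 1) / 2 :> R.
    by rewrite divr_gt0 // mulr_gt0 // subr_gt0 ltr1n.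
  apply: (comb_of_psd dB0 am_gt0).
    have dAx0 : 0 <= dA%:R * x by rewrite mulr_ge0.
    exact: (psdmx_span_opp (@flipAK _ _) (@flipBK _ _) (@flipAB _ _) dAx0).
  rewrite !(rmorphM, rmorphB, rmorph_nat, fmorphV) /= oneC /x.
  by field.
exists Zp, Zm; split; [exact: ltW|exact: am0|exact: cp|exact: cm|].
rewrite eZp eZm inv_spanB /x /y.
by congr (@inv_span _ _ _ _ _ _ _ _); field.
Qed.

End OptimalComb.

Theorem theorem4 (R : realType) (dA dB : nat) (hA : (0 < dA)%N)
    (hB : (0 < dB)%N) :
  (exists X : superop R dA dB,
    [/\ virtual_comb X, conjugates_channels X &
        base_norm X = (dA * dB)%:R - dA%:R + 1]) /\
  (forall X : superop R dA dB,
    virtual_comb X -> conjugates_channels X ->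
    (dA * dB)%:R - dA%:R + 1 <= base_norm X).
Proof.
split; last by move=> X; exact: base_norm_lower.
have [Zp [Zm d]] := optimal_decomp R hA hB; have [_ _ cp cm eX] := d.
set X := inv_span _ _ _ _ _ _ in d eX.
(* The optimal decomposition is itself an affine combination: its weights [ap] and [- am] sum to
   1. *)
have vX : virtual_comb X.
  exists 2, (fun i : 'I_2 => if i == 0 then (dA%:R * dB%:R - dA%:R + 2) / 2
                   else - (dA%:R * (dB%:R - 1) / 2)),
    (fun i : 'I_2 => if i == 0 then Zp else Zm); split.
  - by rewrite !big_ord_recl big_ord0 /=; field.
  - by move=> i; case: ifP.
  - by rewrite !big_ord_recl big_ord0 /= addr0 rmorphN scaleNr.
have cX : conjugates_channels X.
  apply: conjugates_channels_swap_span.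
  have dA1 : dA%:R + 1 != 0 :> R[i] by rewrite natr1 pnatr_eq0.
  by field.
exists X; split=> //; apply/eqP; rewrite eq_le base_norm_lower // andbT.
apply: ge_inf.
  by exists 0 => _ [ap [am [Yp [Ym [[? ? _ _ _] ->]]]]]; rewrite addr_ge0.
exists ((dA%:R * dB%:R - dA%:R + 2) / 2), (dA%:R * (dB%:R - 1) / 2), Zp, Zm.
by split=> //; rewrite natrM; field.
Qed.
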